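(* Let $p$ be a prime, let $r$ and $e$ be positive integers with $p^{r-1}\le e<p^r$, put $\gamma=p^r-e$, and for $2\le k\le r$ let $\gamma_k$ be the least nonnegative residue of $\gamma$ modulo $p^k$. If $$1\le\gamma_k\le\left\lfloor\frac{p^{k-1}+2}{4}\right\rfloor$$ for some $k$ with $2\le k\le r$, then for all integers $n,w$ with $1\le w\le n-1$ there is no nontrivial $e$-perfect code in $J(n,w)$.
   Context: The Johnson scheme $J(n,w)$ has as elements all $w$-subsets of $[n]=\{1,\dots,n\}$, with distance $d(X,Y)=|X\setminus Y|$. The $e$-ball centred at $X$ is the set of $w$-subsets at distance at most $e$ from $X$. An $e$-perfect code in $J(n,w)$ is a set $\mathcal C$ of $w$-subsets such that the $e$-balls centred at the elements of $\mathcal C$ partition the set of all $w$-subsets of $[n]$. It is trivial if $e=0$, or $|\mathcal C|=1$, or $n=2w$, $w=2e+1$ and $\mathcal C$ consists of a $w$-subset and its complement; otherwise it is nontrivial. *)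

(* Defs.v *)
From mathcomp Require Import all_boot.

Set Implicit Arguments.
Unset Strict Implicit.
Unset Printing Implicit Defensive.

Definition johnson (n w : nat) : {set {set 'I_n}} :=
  [set X : {set 'I_n} | #|X| == w].

Definition johnson_dist (n : nat) (X Y : {set 'I_n}) : nat := #|X :\: Y|.

Definition johnson_ball (n w e : nat) (X : {set 'I_n}) : {set {set 'I_n}} :=
  [set Y in johnson n w | johnson_dist X Y <= e].

(* The balls partition the scheme as a family indexed by C: distinct codewords
   have disjoint balls. Using [partition] on the set of balls would instead
   merge codewords having the same ball, e.g. when e is at least the diameter. *)
Definition perfect_code (n w e : nat) (C : {set {set 'I_n}}) : Prop :=
  [/\ C \subset johnson n w,
      \bigcup_(X in C) johnson_ball w e X = johnson n w
    & {in C &, forall X Y, X != Y ->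
         [disjoint johnson_ball w e X & johnson_ball w e Y]}].

Definition trivial_code (n w e : nat) (C : {set {set 'I_n}}) : Prop :=
  [\/ e = 0, #|C| = 1
    | [/\ n = 2 * w, w = 2 * e + 1
        & exists2 X, X \in johnson n w & C = [set X; ~: X]]].

(* Main.v *)
Require Import Defs.
From mathcomp Require Import all_boot.
From mathcomp Require Import all_fingroup all_algebra.
From mathcomp Require Import zify.

(** Write w' = n - w and let Phi be the size of an e-ball, the sum over i <= e
    of C(w, i) C(w', i).  Put q = p^(k-1) and let g be the residue gamma_k, so
    that e = - g mod p^k and 4 g <= q + 2.  Suppose a nontrivial e-perfect code
    exists.  The number Phi is then divisible by p^2, while it also has to
    divide a binomial coefficient which is not divisible by p^2.

    Divisibility of Phi.  The codewords at the minimal distance 2e+1 from a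
    codeword X give Steiner systems S(e+1, 2e+1, w) on the points of X, so that C(e+g, g) divides C(w-e-1+g, g) ([steiner_dvd]).  Since e + g is a
    multiple of p^k, Kummer's theorem turns this into a carry out of digit
    k-1, which says that w = - u mod p^k with g <= u < 2g
    ([residue_of_code]).  The complementary code gives w' = - u' in the same
    way, and u + u' <= 4g - 2 <= q.  Vandermonde's identity splits the multiples of
    p^k off w and w'.  The terms that are not divisible by p^2 for an
    evident reason are multiples of C(2p^k-u-u', p^k-u), and adding p^k - u
    and p^k - u' produces carries out of the two digits k-2 and k-1, because
    u + u' <= q ([ball_size_dvd]).

    A multiple of Phi.  A product of t disjoint differences [x in Y] - [y in Y]
    is an eigenvector of the operator summing over e-balls, with eigenvalue
    an Eberlein polynomial.  As long as the eigenvalues for 1, ..., t do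
    not vanish, these signed sums over the code are zero, which makes
    the code a t-design, and then Phi divides C(n-t, w-t)
    ([perfect_design_dvd]).  The eigenvalue is positive when
    (t-1) e^2 < (w-t-e+1) (w'-t-e+1) ([layer_value_gt0]).  Assume w <= w', as
    complementation allows.  Counting the words at distance e+2 from a codeword
    that are covered by codewords at distance 2e+1 bounds w and w' from below
    ([second_layer]), enough to get the inequality for all t with
    2t < w ([design_range_arith]).

    Conclusion.  A packing argument gives Roos' bound, hence 3 w' <= 4 w
    ([roos_packing]).  Let m be w with all base-p digits but the leading one
    replaced by 0.  Then t = w - m satisfies 2t < w, and m + w' has at most one
    carry ([top_digit]), so p^2 does not divide C(m+w', m) = C(n-t, w-t). *)

Set Implicit Arguments.
Unset Strict Implicit.
Unset Printing Implicit Defensive.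

(** * Counting sets by their position relative to fixed sets *)

Section Counting.
Variable T : finType.
Implicit Types (A B I J S X Y Z : {set T}) (P : pred {set T}).

(** A set is the pair of its traces on [S] and on the complement of [S], and
    these are chosen independently. *)
Lemma card_set_trace S P1 P2 :
  #|[set A : {set T} | P1 (A :&: S) && P2 (A :\: S)]| =
  #|[set A : {set T} | (A \subset S) && P1 A]| * #|[set A : {set T} | (A \subset ~: S) && P2 A]|.
Proof.
rewrite -cardsX -(card_in_imset (f := fun A : {set T} => (A :&: S, A :\: S))); last first.
  by move=> A B _ _ [eI eD]; rewrite -(setID A S) eI eD setID.
apply: eq_card => -[A B]; rewrite !inE /=; apply/imsetP/idP => [[D]|].
  rewrite inE => /andP[h1 h2] [-> ->]; rewrite subsetIr h1 h2 andbT /=.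
  by rewrite setDE subsetIr.
case/andP=> /andP[sA h1] /andP[sB h2].
have eA : (A :|: B) :&: S = A.
  apply/setP=> x; rewrite !inE; move/subsetP/(_ x): sA; move/subsetP/(_ x): sB.
  by rewrite !inE; case: (x \in A); case: (x \in B); case: (x \in S) => // h h'; (have:= h isT) || (have:= h' isT).
have eB : (A :|: B) :\: S = B.
  apply/setP=> x; rewrite !inE; move/subsetP/(_ x): sA; move/subsetP/(_ x): sB.
  by rewrite !inE; case: (x \in A); case: (x \in B); case: (x \in S) => // h h'; (have:= h isT) || (have:= h' isT).
by exists (A :|: B); rewrite ?inE ?eA ?eB ?h1 ?h2.
Qed.

(** A set [Y] can be coded by what it removes from [X] and what it adds to [X];
    words near a codeword [X] are always counted in these coordinates. *)
Lemma card_set_flip X P1 P2 :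
  #|[set Y : {set T} | P1 (X :\: Y) && P2 (Y :\: X)]| =
  #|[set A : {set T} | (A \subset X) && P1 A]| * #|[set A : {set T} | (A \subset ~: X) && P2 A]|.
Proof.
pose flip Y := (X :\: Y) :|: (Y :\: X).
have flipI Y : flip Y :&: X = X :\: Y.
  by apply/setP=> x; rewrite !inE; case: (x \in X); case: (x \in Y).
have flipD Y : flip Y :\: X = Y :\: X.
  by apply/setP=> x; rewrite !inE; case: (x \in X); case: (x \in Y).
have flipK : involutive flip.
  by move=> Y; apply/setP=> x; rewrite !inE; case: (x \in X); case: (x \in Y).
rewrite -card_set_trace -[RHS](card_preimset _ (inv_inj flipK)).
by apply: eq_card => Y; rewrite !inE flipI flipD.
Qed.

Lemma exists_subset A k : k <= #|A| -> exists2 B : {set T}, B \subset A & #|B| = k.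
Proof.
move=> hk; have : 0 < #|[set B : {set T} | B \subset A & #|B| == k]|.
  by rewrite cards_draws bin_gt0.
by case/card_gt0P=> B; rewrite inE => /andP[sB /eqP cB]; exists B.
Qed.

Lemma card_between I0 X m : I0 \subset X ->
  #|[set I : {set T} | (I \subset X) && ((I0 \subset I) && (#|I| == #|I0| + m))]|
  = 'C(#|X| - #|I0|, m).
Proof.
move=> sX.
have -> : [set I : {set T} | (I \subset X) && ((I0 \subset I) && (#|I| == #|I0| + m))] =
   [set I : {set T} | (I :&: I0 == I0) && ((I :\: I0 \subset X) && (#|I :\: I0| == m))].
  apply/setP=> I; rewrite !inE (sameP (@setIidPr _ I I0) eqP).
  case: (I :&: I0 =P I0) => [eI|_]; last by rewrite andbF.
  rewrite /= -(cardsID I0 I) eI eqn_add2l; congr (_ && _).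
  by rewrite -[in LHS](setID I I0) subUset eI sX.
rewrite (card_set_trace I0 (pred1 I0)
  (fun A : {set T} => (A \subset X) && (#|A| == m))).
have -> : [set A : {set T} | (A \subset I0) && pred1 I0 A] = [set I0].
  apply/setP=> A; rewrite !inE /=; case: eqP => [->|_]; last by rewrite andbF.
  by rewrite subxx.
rewrite cards1 mul1n -(cardsDS sX) -cards_draws; apply: eq_card => A.
by rewrite !inE andbA setDE subsetI [(A \subset X) && _]andbC.
Qed.

Lemma card_set_meet I0 X a b : I0 \subset X ->
  #|[set I : {set T} | (I \subset X) && ((#|I :&: I0| == a) && (#|I :\: I0| == b))]|
  = 'C(#|I0|, a) * 'C(#|X| - #|I0|, b).
Proof.
move=> sX.
have -> : [set I : {set T} | (I \subset X) && ((#|I :&: I0| == a) && (#|I :\: I0| == b))] =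
   [set I : {set T} | (#|I :&: I0| == a) && ((I :\: I0 \subset X) && (#|I :\: I0| == b))].
  apply/setP=> I; rewrite !inE.
  have -> : (I \subset X) = (I :\: I0 \subset X).
    rewrite -[in LHS](setID I I0) subUset.
    by rewrite (subset_trans (subsetIr _ _) sX).
  by case: (#|_| == a); rewrite ?andbF.
rewrite (card_set_trace I0 (fun A : {set T} => #|A| == a)
  (fun A : {set T} => (A \subset X) && (#|A| == b))).
rewrite cards_draws; congr (_ * _).
rewrite -(cardsDS sX) -cards_draws; apply: eq_card => A.
by rewrite !inE andbA setDE subsetI [(A \subset X) && _]andbC.
Qed.

(** The distance from [Z] to [Y] read in the coordinates centred at [X]. *)
Lemma card_setD_via X Y Z :
  #|Z :\: Y| = #|(X :\: Y) :\: (X :\: Z)| + #|(Z :\: X) :\: (Y :\: X)|.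
Proof.
rewrite -(cardsID X); congr (_ + _); apply: eq_card => x; rewrite !inE;
by case: (x \in X); case: (x \in Y); case: (x \in Z).
Qed.

Lemma card_setD_sym X Y : #|X| = #|Y| -> #|X :\: Y| = #|Y :\: X|.
Proof. by move=> h; rewrite !cardsD h setIC. Qed.

Lemma eq_card_setD X Y : (#|X| == #|Y|) = (#|X :\: Y| == #|Y :\: X|).
Proof. by rewrite -(cardsID Y X) -(cardsID X Y) [Y :&: X]setIC eqn_add2l. Qed.

End Counting.

(** * Perfect codes as exact covers *)

Section PerfectCode.
Variables (n w e : nat) (C : {set {set 'I_n}}).
Hypothesis perfC : perfect_code w e C.
Implicit Types X Y Z I J : {set 'I_n}.

Lemma perfect_card X : X \in C -> #|X| = w.
Proof. by case: perfC => sC _ _ /(subsetP sC); rewrite inE => /eqP. Qed.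

Lemma perfect_cover Y : #|Y| = w -> exists2 X, X \in C & #|X :\: Y| <= e.
Proof.
move=> cY; case: perfC => _ cov _.
have : Y \in johnson n w by rewrite inE cY.
rewrite -cov => /bigcupP[X XC]; rewrite inE => /andP[_ dXY].
by exists X.
Qed.

Lemma perfect_uniq X Z Y : X \in C -> Z \in C -> #|Y| = w ->
  #|X :\: Y| <= e -> #|Z :\: Y| <= e -> X = Z.
Proof.
move=> XC ZC cY dX dZ; apply/eqP/idPn => neXZ; case: perfC => _ _ /(_ X Z XC ZC neXZ).
move/pred0P/(_ Y) => /=; rewrite !inE cY eqxx /=.
by rewrite /johnson_dist dX dZ.
Qed.

(** The only way in which the covering is used: a sum over all words is the sum
    over the codewords of the sums over their balls. *)
Lemma perfect_big (R : Type) (idx : R) (op : Monoid.com_law idx)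
    (f : {set 'I_n} -> R) :
  \big[op/idx]_(Y : {set 'I_n} | #|Y| == w) f Y =
  \big[op/idx]_(X in C)
    \big[op/idx]_(Y : {set 'I_n} | (#|Y| == w) && (#|X :\: Y| <= e)) f Y.
Proof.
rewrite (exchange_big_dep (fun Y => #|Y| == w)) /=; last first.
  by move=> X Y _ /andP[].
apply: eq_bigr => Y /eqP cY; case: (perfect_cover cY) => X XC dXY.
rewrite (big_pred1 X) // => Z /=; apply/idP/eqP => [/andP[ZC /andP[_ dZ]]|->].
  exact: perfect_uniq cY dZ dXY.
by rewrite XC cY eqxx.
Qed.

Lemma perfect_count (P : pred {set 'I_n}) :
  (forall Y, P Y -> #|Y| = w) ->
  #|[set Y | P Y]| = \sum_(X in C) #|[set Y | P Y && (#|X :\: Y| <= e)]|.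
Proof.
move=> Pw.
have indic (Q : pred {set 'I_n}) :
    #|[set Y | P Y && Q Y]| = \sum_(Y : {set 'I_n} | (#|Y| == w) && Q Y) P Y.
  rewrite -sum1_card [LHS]big_mkcond [RHS]big_mkcond /=.
  apply: eq_bigr => Y _; rewrite inE; case PY: (P Y); rewrite ?if_same //=.
  by rewrite (Pw _ PY) eqxx.
have -> : [set Y | P Y] = [set Y | P Y && xpredT Y].
  by apply/setP=> Y; rewrite !inE andbT.
rewrite indic (eq_bigl (fun Y => #|Y| == w)) => [|Y]; last by rewrite andbT.
rewrite perfect_big.
by apply: eq_bigr => X _; rewrite indic.
Qed.

(** If [X] and [Z] were closer, moving [minn e d] of the [d] elements of
    [X :\: Z] towards [Z] would give a word in both balls. *)
Lemma perfect_dist X Z : X \in C -> Z \in C -> X != Z -> 2 * e < #|X :\: Z|.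
Proof.
move=> XC ZC neXZ; rewrite ltnNge; apply/negP => le2.
have cX := perfect_card XC; have cZ := perfect_card ZC.
have cZX : #|Z :\: X| = #|X :\: Z| by apply: card_setD_sym; rewrite cX.
have [I sI cI] : exists2 I : {set 'I_n}, I \subset X :\: Z & #|I| = minn e #|X :\: Z|.
  by apply: exists_subset; rewrite geq_minr.
have [J sJ cJ] : exists2 J : {set 'I_n}, J \subset Z :\: X & #|J| = minn e #|X :\: Z|.
  by apply: exists_subset; rewrite cZX geq_minr.
pose Y := (X :\: I) :|: J.
have sub x : ((x \in I) ==> (x \in X) && (x \notin Z)) && ((x \in J) ==> (x \in Z) && (x \notin X)).
  apply/andP; split; apply/implyP => h;
    [have := subsetP sI x h | have := subsetP sJ x h]; by case/setDP=> -> ->.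
have XY : X :\: Y = I.
  by apply/setP=> x; have := sub x; rewrite !inE; case: (x \in X); case: (x \in I); case: (x \in J); case: (x \in Z).
have YX : Y :\: X = J.
  by apply/setP=> x; have := sub x; rewrite !inE; case: (x \in X); case: (x \in I); case: (x \in J); case: (x \in Z).
have cY : #|Y| = w by apply/eqP; rewrite -cX eq_sym eq_card_setD XY YX cI cJ.
have dX : #|X :\: Y| <= e by rewrite XY cI geq_minl.
have dZ : #|Z :\: Y| <= e.
  rewrite (card_setD_via X) XY YX (cardsDS sJ) cZX cJ.
  have -> : I :\: (X :\: Z) = set0 by apply/eqP; rewrite setD_eq0.
  rewrite cards0; lia.
by move: neXZ; rewrite (perfect_uniq XC ZC cY dX dZ) eqxx.
Qed.

End PerfectCode.

Lemma perfect_codeC n w e (C : {set {set 'I_n}}) :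
  w <= n -> perfect_code w e C -> perfect_code (n - w) e [set ~: X | X in C].
Proof.
move=> le_wn perfC.
have cC (X : {set 'I_n}) : #|~: X| = n - #|X| by rewrite cardsCs setCK card_ord.
have dC (X Y : {set 'I_n}) : #|X| = #|Y| -> #|~: X :\: ~: Y| = #|X :\: Y|.
  by move=> h; rewrite (card_setD_sym h) setDE setCK setIC -setDE.
have cY (Y : {set 'I_n}) : #|Y| = n - w -> #|~: Y| = w by rewrite cC => ->; rewrite subKn.
split.
- apply/subsetP=> _ /imsetP[X XC ->].
  by rewrite inE cC (perfect_card perfC XC).
- apply/setP=> Y; apply/bigcupP/idP => [[X _]|]; first by rewrite inE => /andP[].
  rewrite inE => /eqP /[dup] cYe /cY cY'; have [X XC dX] := perfect_cover perfC cY'.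
  exists (~: X); first exact: imset_f.
  by rewrite !inE cYe eqxx /= /johnson_dist -[Y]setCK dC ?setCK // cY' (perfect_card perfC XC).
move=> _ _ /imsetP[X XC ->] /imsetP[Z ZC ->].
rewrite (inj_eq (@setC_inj _)) => neXZ.
apply/pred0P => Y /=; apply/negP; rewrite !inE /johnson_dist.
case/andP=> /andP[/eqP /cY cY' dX] /andP[_ dZ].
have eX := perfect_card perfC XC; have eZ := perfect_card perfC ZC.
have XZ : X = Z.
  apply: (perfect_uniq perfC XC ZC cY').
    by rewrite -dC ?setCK // cY'.
  by rewrite -dC ?setCK // cY'.
by rewrite XZ eqxx in neXZ.
Qed.

(** * The two layers just outside the ball of a codeword *)

Lemma subset_card0 (T : finType) (A B : {set T}) : (A \subset B) = (#|A :\: B| == 0).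
Proof. by rewrite cards_eq0 setD_eq0. Qed.

Section Local.
Variables (n w e : nat) (C : {set {set 'I_n}}).
Hypothesis perfC : perfect_code w e C.
Variable X : {set 'I_n}.
Hypothesis XC : X \in C.
Implicit Types Y Z I J : {set 'I_n}.

Definition neighbours := [set Z in C | #|X :\: Z| == 2 * e + 1].

Lemma neighbourP Z : Z \in neighbours ->
  [/\ Z \in C, #|X :\: Z| = 2 * e + 1 & #|Z :\: X| = 2 * e + 1].
Proof.
rewrite inE => /andP[ZC /eqP cXZ]; split=> //; rewrite -cXZ.
by apply: card_setD_sym; rewrite (perfect_card perfC XC) (perfect_card perfC ZC).
Qed.

(** A word at distance [e.+1] from [X] lies in the ball of a codeword [Z] only if
    [Z] is as close to [X] as the minimal distance permits, and then the word
    lies on a geodesic from [X] to [Z]. *)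
Lemma cover_next_layer Y Z : Z \in C ->
    #|X :\: Y| = e.+1 -> #|Y :\: X| = e.+1 ->
  (#|Z :\: Y| <= e) =
  [&& Z \in neighbours, X :\: Y \subset X :\: Z & Y :\: X \subset Z :\: X].
Proof.
move=> ZC cI cJ; rewrite !inE ZC /= (card_setD_via X) !subset_card0.
have [<-|neXZ] := eqVneq X Z; first by rewrite setDv !setD0 set0D cards0 cI; lia.
have := perfect_dist perfC XC ZC neXZ.
have cs : #|X :\: Z| = #|Z :\: X|.
  by apply: card_setD_sym; rewrite (perfect_card perfC XC) (perfect_card perfC ZC).
have := cardsID (Y :\: X) (Z :\: X); have := cardsID (Z :\: X) (Y :\: X).
rewrite [(Y :\: X) :&: _]setIC cJ cs. lia.
Qed.

Lemma card_of_balanced Y : #|X :\: Y| = #|Y :\: X| -> #|Y| = w.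
Proof.
by move/eqP; rewrite -eq_card_setD => /eqP <-; apply: (perfect_card perfC XC).
Qed.

(** Every pair of [e.+1]-sets inside and outside [X] extends to exactly one
    neighbour.  Counting the pairs that satisfy [P1] and [P2] in two ways gives
    all the incidence identities used below. *)
Lemma next_layer (P1 P2 : pred {set 'I_n}) :
  \sum_(Z in neighbours)
     #|[set I : {set 'I_n} | (I \subset X :\: Z) && ((#|I| == e.+1) && P1 I)]| *
     #|[set J : {set 'I_n} | (J \subset Z :\: X) && ((#|J| == e.+1) && P2 J)]| =
  #|[set I : {set 'I_n} | (I \subset X) && ((#|I| == e.+1) && P1 I)]| *
  #|[set J : {set 'I_n} | (J \subset ~: X) && ((#|J| == e.+1) && P2 J)]|.
Proof.
rewrite -(card_set_flip X (fun I : {set 'I_n} => (#|I| == e.+1) && P1 I)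
                      (fun J : {set 'I_n} => (#|J| == e.+1) && P2 J)).
rewrite (perfect_count perfC (P := fun Y =>
  ((#|X :\: Y| == e.+1) && P1 (X :\: Y)) &&
  ((#|Y :\: X| == e.+1) && P2 (Y :\: X)))); last first.
  by move=> Y /andP[/andP[/eqP h1 _] /andP[/eqP h2 _]]; apply: card_of_balanced; rewrite h1.
rewrite [RHS](bigID (mem neighbours)) /= [X in _ + X]big1 ?addn0; last first.
  move=> Z /andP[ZC nZ]; apply: eq_card0 => Y; rewrite !inE; apply/negP.
  case/andP=> /andP[/andP[/eqP h1 _] /andP[/eqP h2 _]].
  by rewrite cover_next_layer // (negbTE nZ).
apply: eq_big => [Z|Z Znb]; first by rewrite inE; case: (Z \in C).
have [ZC cXZ cZX] := neighbourP Znb.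
transitivity #|[set Y : {set 'I_n} |
   ((X :\: Y \subset X :\: Z) && ((#|X :\: Y| == e.+1) && P1 (X :\: Y))) &&
   ((Y :\: X \subset Z :\: X) && ((#|Y :\: X| == e.+1) && P2 (Y :\: X)))]|.
  rewrite (card_set_flip X
    (fun I : {set 'I_n} => (I \subset X :\: Z) && ((#|I| == e.+1) && P1 I))
    (fun J : {set 'I_n} => (J \subset Z :\: X) && ((#|J| == e.+1) && P2 J))).
  congr (_ * _); apply: eq_card => I; rewrite !inE; apply/idP/idP; try by case/andP.
    by move=> h; rewrite h andbT (subset_trans _ (subsetDl X Z)) //; case/andP: h.
  move=> h; rewrite h andbT; case/andP: h => h _.
  by apply: subset_trans h _; rewrite setDE subsetIr.
apply: eq_card => Y; rewrite !inE.
have [h1|_] := eqVneq #|X :\: Y| e.+1; last by rewrite !(andbF, andFb).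
have [h2|_] := eqVneq #|Y :\: X| e.+1; last by rewrite !(andbF, andFb).
rewrite cover_next_layer // Znb /=.
by rewrite -!andbA; do !bool_congr.
Qed.

Lemma card_compl : #|~: X| = n - w.
Proof. by rewrite cardsCs setCK card_ord (perfect_card perfC XC). Qed.

Let b := 'C(2 * e + 1, e.+1).

Lemma card_draws_true (S : {set 'I_n}) k :
  #|[set I : {set 'I_n} | (I \subset S) && ((#|I| == k) && true)]| = 'C(#|S|, k).
Proof. by rewrite -cards_draws; apply: eq_card => I; rewrite !inE andbT. Qed.

Lemma card_neighbours :
  #|neighbours| * (b * b) = 'C(w, e.+1) * 'C(n - w, e.+1).
Proof.
have := next_layer xpredT xpredT; rewrite !card_draws_true card_compl.
rewrite (perfect_card perfC XC) => <-; rewrite -sum_nat_const.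
apply: eq_bigr => Z /neighbourP[_ cI cJ]; by rewrite !card_draws_true cI cJ.
Qed.

Lemma card_draws_over (I0 S : {set 'I_n}) m : I0 \subset S ->
  #|[set I : {set 'I_n} | (I \subset S) && ((#|I| == #|I0| + m) && (I0 \subset I))]|
  = 'C(#|S| - #|I0|, m).
Proof.
by move=> sI; rewrite -card_between //; apply: eq_card => I; rewrite !inE [(I0 \subset I) && _]andbC.
Qed.

Lemma card_draws_over0 (I0 S : {set 'I_n}) (P : pred {set 'I_n}) : ~~ (I0 \subset S) ->
  #|[set I : {set 'I_n} | (I \subset S) && (P I && (I0 \subset I))]| = 0.
Proof.
move=> nI; apply: eq_card0 => I; rewrite !inE; apply/negP => /and3P[sI _ sI0].
by rewrite (subset_trans sI0 sI) in nI.
Qed.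

(** Fix the outer set [J0].  The inner sets of the neighbours above [J0] form a
    Steiner system on [X], and the divisibility is its condition for the
    blocks through [e.+1 - g] fixed points. *)
Lemma steiner_dvd g : g <= e.+1 -> e.+1 <= w -> e.+1 <= n - w ->
  'C(e + g, g) %| 'C(w - e.+1 + g, g).
Proof.
move=> le_ge le_ew le_ew'.
have [I0 sI0 cI0] : exists2 I0 : {set 'I_n}, I0 \subset X & #|I0| = e.+1 - g.
  by apply: exists_subset; rewrite (perfect_card perfC XC); lia.
have [J0 sJ0 cJ0] : exists2 J0 : {set 'I_n}, J0 \subset ~: X & #|J0| = e.+1.
  by apply: exists_subset; rewrite card_compl.
have e1 : e.+1 = #|I0| + g by rewrite cI0; lia.
have := next_layer (fun I => I0 \subset I) (pred1 J0).
rewrite [in X in _ = X * _]e1 card_draws_over // (perfect_card perfC XC) cI0.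
have -> : #|[set J : {set 'I_n} | (J \subset ~: X) && ((#|J| == e.+1) && pred1 J0 J)]| = 1.
  rewrite -(cards1 J0); apply: eq_card => J; rewrite !inE /=.
  by case: (J =P J0) => [->|]; rewrite ?andbF // sJ0 cJ0 eqxx.
have -> : w - (e.+1 - g) = w - e.+1 + g by lia.
rewrite muln1 => <-; apply: dvdn_sum => Z /neighbourP[_ cI cJ].
have [sIZ|nIZ] := boolP (I0 \subset X :\: Z); last by rewrite card_draws_over0 ?mul0n.
rewrite {1}e1 card_draws_over // cI cI0 dvdn_mulr //.
by have -> : 2 * e + 1 - (e.+1 - g) = e + g by lia.
Qed.

(** Roos' bound.  Take the neighbours whose outer part contains a fixed [e]-set.
    Two of them cannot share [e.+2] removed points without being at distance at
    most [2 * e], so they pack the [e.+2]-subsets of [X]; the number of these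
    neighbours grows with [n - w]. *)
Lemma roos_packing : 0 < e -> e <= n - w -> e.+1 <= w ->
  e * (n - w - e) <= e.+1 * (w - e.+1).
Proof.
move=> e_gt0 le_ew' le_ew.
have [J0 sJ0 cJ0] : exists2 J0 : {set 'I_n}, J0 \subset ~: X & #|J0| = e.
  by apply: exists_subset; rewrite card_compl.
pose nbJ := [set Z in neighbours | J0 \subset Z :\: X].
have count1 : #|nbJ| * (b * e.+1) = 'C(w, e.+1) * (n - w - e).
  have := next_layer xpredT (fun J => J0 \subset J).
  have e1 : e.+1 = #|J0| + 1 by rewrite cJ0 addn1.
  rewrite !card_draws_true [in X in _ = _ * X]e1 (card_draws_over 1 sJ0) cJ0 card_compl.
  rewrite bin1 (perfect_card perfC XC) => <-; rewrite -sum_nat_const.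
  rewrite [LHS](eq_bigl (fun Z => (Z \in neighbours) && (J0 \subset Z :\: X))); last first.
    by move=> Z; rewrite inE.
  rewrite big_mkcondr /=; apply: eq_bigr => Z /neighbourP[_ cI cJ].
  case: ifP => [sJZ|/negbT nJZ]; last by rewrite card_draws_over0 ?muln0.
  rewrite card_draws_true cI [in X in _ = _ * X]e1 (card_draws_over 1 sJZ) cJ cJ0 bin1.
  by congr (_ * _); lia.
have count2 : #|nbJ| * 'C(2 * e + 1, e.+2) <= 'C(w, e.+2).
  pose sub Z := [set I : {set 'I_n} | (I \subset X :\: Z) && (#|I| == e.+2)].
  have -> : #|nbJ| * 'C(2 * e + 1, e.+2) = \sum_(Z in nbJ) #|sub Z|.
    rewrite -sum_nat_const; apply: eq_bigr => Z.
    by rewrite inE => /andP[/neighbourP[_ cI _] _]; rewrite cards_draws cI.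
  have -> : 'C(w, e.+2) = \sum_(I : {set 'I_n} | (I \subset X) && (#|I| == e.+2)) 1.
    by rewrite sum1dep_card cards_draws (perfect_card perfC XC).
  under eq_bigr do rewrite -sum1_card.
  rewrite (exchange_big_dep (fun I : {set 'I_n} => (I \subset X) && (#|I| == e.+2))) /=.
    apply: leq_sum => I /andP[sI /eqP cI]; rewrite sum1dep_card.
    have mem_sub Z : Z \in [set Z in nbJ | I \in sub Z] ->
        [/\ Z \in neighbours, J0 \subset Z :\: X & I \subset X :\: Z].
      by rewrite inE => /andP[]; rewrite inE => /andP[nZ sZ]; rewrite inE => /andP[iZ _].
    apply/card_le1_eqP => Z1 Z2 /mem_sub[/neighbourP[Z1C c1 d1] s1 i1].
    move=> /mem_sub[/neighbourP[Z2C c2 d2] s2 i2].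
    apply/eqP/idPn; rewrite eq_sym => neZ; have := perfect_dist perfC Z1C Z2C neZ.
    rewrite (card_setD_via X).
    have : #|(X :\: Z2) :\: (X :\: Z1)| <= #|(X :\: Z2) :\: I|.
      by apply/subset_leq_card/setDS.
    have : #|(Z1 :\: X) :\: (Z2 :\: X)| <= #|(Z1 :\: X) :\: J0|.
      by apply/subset_leq_card/setDS.
    rewrite (cardsDS i2) (cardsDS s1) c2 d1 cI cJ0; lia.
  move=> Z I; rewrite !inE => /andP[_ _] /andP[sI ->]; rewrite andbT.
  exact: subset_trans sI (subsetDl _ _).
have c_gt0 : 0 < 'C(w, e.+1) by rewrite bin_gt0.
have h1 := mul_bin_left w e.+1; have h2 := mul_bin_left (2 * e + 1) e.+1.
have h3 : 2 * e + 1 - e.+1 = e by lia.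
rewrite h3 -/b in h2.
rewrite -(leq_pmul2l c_gt0) mulnCA -count1.
have -> : e * (#|nbJ| * (b * e.+1)) = e.+1 * (#|nbJ| * (e * b)) by lia.
have -> : 'C(w, e.+1) * (e.+1 * (w - e.+1)) = e.+1 * ((w - e.+1) * 'C(w, e.+1)) by lia.
by rewrite -h1 -h2 leq_mul2l mulnCA leq_mul2l count2 orbT.
Qed.

Let b2 := 'C(2 * e + 1, e.+2).

(** Three kinds of words at distance [e.+2] from [X] lie in the ball of a
    neighbour [Z]: those on a geodesic from [X] to [Z], and those with one
    removed or one added point off the geodesics. *)
Lemma card_second_layer Z : Z \in neighbours ->
  b2 * b2 + b2 * b * (w - (2 * e + 1)) + b2 * b * (n - w - (2 * e + 1)) <=
  #|[set Y : {set 'I_n} | ((#|X :\: Y| == e.+2) && (#|Y :\: X| == e.+2)) &&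
     (#|Z :\: Y| <= e)]|.
Proof.
move=> Znb; have [ZC cI cJ] := neighbourP Znb.
(* [i] removed points and [j] added points lie outside those of [Z] *)
pose fam i j := [set Y : {set 'I_n} |
   ((#|(X :\: Y) :&: (X :\: Z)| == e.+2 - i) && (#|(X :\: Y) :\: (X :\: Z)| == i)) &&
   ((#|(Y :\: X) :&: (Z :\: X)| == e.+2 - j) && (#|(Y :\: X) :\: (Z :\: X)| == j))].
have card_fam i j : #|fam i j| =
   ('C(2 * e + 1, e.+2 - i) * 'C(w - (2 * e + 1), i)) *
   ('C(2 * e + 1, e.+2 - j) * 'C(n - w - (2 * e + 1), j)).
  rewrite (card_set_flip X
     (fun I : {set 'I_n} => (#|I :&: (X :\: Z)| == e.+2 - i) && (#|I :\: (X :\: Z)| == i))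
     (fun J : {set 'I_n} => (#|J :&: (Z :\: X)| == e.+2 - j) && (#|J :\: (Z :\: X)| == j))).
  rewrite card_set_meet ?subsetDl // card_set_meet ?setDE ?subsetIr // -?setDE.
  by rewrite cI cJ (perfect_card perfC XC) card_compl.
have fam_disj i j i' j' : (i, j) != (i', j') -> fam i j :&: fam i' j' = set0.
  move=> ne; apply/setP => Y; rewrite !inE; apply/negP.
  case/andP=> /andP[/andP[_ /eqP h1] /andP[_ /eqP h2]].
  case/andP=> /andP[_ /eqP h3] /andP[_ /eqP h4].
  by move: ne; rewrite -h1 -h2 h3 h4 eqxx.
have e21 : e.+2 - 1 = e.+1 by lia.
have <- : #|fam 0 0 :|: fam 1 0 :|: fam 0 1| =
  b2 * b2 + b2 * b * (w - (2 * e + 1)) + b2 * b * (n - w - (2 * e + 1)).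
  rewrite !cardsU setIUl !fam_disj // setU0 cards0 !subn0.
  rewrite !card_fam !subn0 e21 !bin0 !bin1 -/b -/b2; lia.
apply/subset_leq_card/subsetP => Y; rewrite !inE (card_setD_via X Y Z).
have := cardsID (X :\: Z) (X :\: Y).
have := cardsID (Z :\: X) (Y :\: X); have := cardsID (Y :\: X) (Z :\: X).
rewrite [(Z :\: X) :&: _]setIC cJ; lia.
Qed.

(** The balls of the neighbours are disjoint, so together they contain at most
    all the words at distance [e.+2].  With [z = w - e.+1], [z' = n - w - e.+1]
    and [A = e * e.+2] the bound reads [(z - A) * (z' - A) >= (e * e.+1) ^ 2]
    over the integers. *)
Lemma second_layer : e.+2 <= w -> e.+2 <= n - w -> 2 * e < w -> 2 * e < n - w ->
  e * e + e * e.+2 * (n - (4 * e + 2)) <= (w - e.+1) * (n - w - e.+1).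
Proof.
move=> lw lw' lw2 lw2'.
have count : #|neighbours| * (b2 * b2 + b2 * b * (w - (2 * e + 1)) +
      b2 * b * (n - w - (2 * e + 1))) <= 'C(w, e.+2) * 'C(n - w, e.+2).
  have <- : #|[set Y : {set 'I_n} | (#|X :\: Y| == e.+2) && (#|Y :\: X| == e.+2)]| =
      'C(w, e.+2) * 'C(n - w, e.+2).
    rewrite (card_set_flip X (fun I : {set 'I_n} => #|I| == e.+2) (fun I : {set 'I_n} => #|I| == e.+2)).
    by rewrite !cards_draws card_compl (perfect_card perfC XC).
  rewrite (perfect_count perfC (P := fun Y =>
    (#|X :\: Y| == e.+2) && (#|Y :\: X| == e.+2))); last first.
    by move=> Y /andP[/eqP h1 /eqP h2]; apply: card_of_balanced; rewrite h1.
  rewrite (bigID (mem neighbours)) /= -sum_nat_const.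
  apply: leq_trans (leq_addr _ _).
  rewrite [leqRHS](eq_bigl (mem neighbours)) => [|Z].
    by apply: leq_sum => Z Znb; apply: card_second_layer.
  by rewrite /= inE; case: (Z \in C).
have h0 := mul_bin_left (2 * e + 1) e.+1.
have h1 := mul_bin_left w e.+1; have h2 := mul_bin_left (n - w) e.+1.
have h3 : 2 * e + 1 - e.+1 = e by lia.
rewrite h3 -/b -/b2 in h0.
have c1 : 0 < 'C(w, e.+1) by rewrite bin_gt0; lia.
have c2 : 0 < 'C(n - w, e.+1) by rewrite bin_gt0; lia.
have cc : 0 < 'C(w, e.+1) * 'C(n - w, e.+1) by rewrite muln_gt0 c1.
rewrite -(leq_pmul2l cc) -{1}card_neighbours.
have -> : n - (4 * e + 2) = (w - (2 * e + 1)) + (n - w - (2 * e + 1)) by lia.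
move: (w - (2 * e + 1)) (n - w - (2 * e + 1)) count => u v count.
have -> : 'C(w, e.+1) * 'C(n - w, e.+1) * ((w - e.+1) * (n - w - e.+1)) =
   (e.+2 * e.+2) * ('C(w, e.+2) * 'C(n - w, e.+2)).
  rewrite mulnACA [_ * (w - _)]mulnC [_ * (n - w - _)]mulnC -h1 -h2.
  by rewrite mulnACA.
have -> : #|neighbours| * (b * b) * (e * e + e * e.+2 * (u + v)) =
   (e.+2 * e.+2) * (#|neighbours| * (b2 * b2 + b2 * b * u + b2 * b * v)).
  have -> : #|neighbours| * (b * b) * (e * e + e * e.+2 * (u + v)) =
     #|neighbours| * ((e * b) * (e * b) + e.+2 * (e * b) * b * (u + v)) by lia.
  by rewrite -h0; lia.
by rewrite leq_mul2l count orbT.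
Qed.

End Local.

(** * Signed counting along pairs and the design property *)

Section SignedCounting.
Import GRing.Theory Num.Theory.
Local Open Scope ring_scope.

(** The coefficient of [x^i * y^i] in [(1 - x*y)^k * (1 + x)^a * (1 + y)^b], a
    value of an Eberlein polynomial.  The recursion in [k] is the multiplication
    by [1 - x*y], which is what one more pair contributes to signed sums. *)
Fixpoint layer_value (a b k i : nat) : int :=
  if k is k'.+1 then
    layer_value a b k' i - (if i is i'.+1 then layer_value a b k' i' else 0)
  else ('C(a, i) * 'C(b, i))%:Z.

(** With [R = (a - e + 1) * (b - e + 1)], the ratio of consecutive values is at
    least [R / e^2] for [k = 0], and each step in [k] lowers this bound by at
    most 1; the values stay positive while [k < R / e^2]. *)
Lemma layer_value_gt0 (a b e k : nat) : (0 < e <= a)%N -> (e <= b)%N ->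
  (k * e ^ 2 < (a - e + 1) * (b - e + 1))%N -> (0 < layer_value a b k e)%R.
Proof.
case/andP=> e_gt0 le_ea le_eb; pose R := ((a - e + 1) * (b - e + 1))%N => ltkR.
have main : forall j, (j * e ^ 2 <= R)%N ->
  (forall i, (i <= e)%N -> (0 <= layer_value a b j i)%R) /\
  (forall i, (i < e)%N ->
   ((R - j * e ^ 2)%N%:Z * layer_value a b j i <= (e ^ 2)%N%:Z * layer_value a b j i.+1)%R).
  elim=> [|j IH] lejR /=.
    split=> [i _|i lt_ie]; first by [].
    rewrite -!PoszM lez_nat mul0n subn0.
    have h1 := mul_bin_left a i; have h2 := mul_bin_left b i.
    have : (R * ('C(a, i) * 'C(b, i)) <= (i.+1 * 'C(a, i.+1)) * (i.+1 * 'C(b, i.+1)))%N.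
      by rewrite h1 h2 mulnACA leq_mul2r /R leq_mul ?orbT //; lia.
    move/leq_trans; apply; rewrite mulnACA leq_mul2r expnS expn1.
    by rewrite leq_mul ?orbT.
  have {IH}[IH1 IH2] := IH ltac:(nia).
  have e2_gt0 : (0 < e ^ 2)%N by rewrite expn_gt0 e_gt0.
  have posS i : (i < e)%N -> (0 <= layer_value a b j i.+1 - layer_value a b j i)%R.
    move=> lt_ie; have h1 := IH1 i (ltnW lt_ie); have h2 := IH2 i lt_ie.
    move: e2_gt0 lejR h1 h2; move: (e ^ 2)%N (layer_value _ _ _ _) (layer_value _ _ _ _).
    move=> d u v d_gt0 le h1 h2; nia.
  split=> [[|i] lt_ie|i lt_ie]; first by rewrite subr0; apply: IH1.
    exact: posS.
  have h1 := IH1 i (ltnW lt_ie); have h2 := IH2 i lt_ie.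
  have : (layer_value a b j i - (if i is i'.+1 then layer_value a b j i' else 0) <= layer_value a b j i)%R.
    by case: (i) lt_ie => [|i'] lt_ie; [lia | have := IH1 i'; lia].
  move: e2_gt0 lejR h1 h2; move: (e ^ 2)%N (layer_value _ _ _ i.+1) (layer_value _ _ _ i) (_ - _).
  move=> d u v t d_gt0 le h1 h2 h3; nia.
have [_ h] := main k (ltnW ltkR).
suff pos i : (i <= e)%N -> (0 < layer_value a b k i)%R by apply: pos.
elim: i => [_|i IHi lt_ie].
  by rewrite {h main ltkR}; elim: k => [|k IHk] /=; rewrite ?bin0 // subr0.
have := h i lt_ie; have := IHi (ltnW lt_ie).
move: (layer_value _ _ _ _) (layer_value _ _ _ _) ltkR; move: (e ^ 2)%N => d u v; rewrite -/R; nia.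
Qed.

Section Pairs.
Variable T : finType.
Implicit Types (x y z : T) (X Y W : {set T}) (P : seq (T * T)).

Definition pair_sign (xy : T * T) Y : int := (xy.1 \in Y)%:Z - (xy.2 \in Y)%:Z.
(** In the language of the symmetric group this is a polytabloid, nonzero only on
    the sets that contain exactly one point of each pair. *)
Definition pairs_sign P Y : int := \prod_(xy <- P) pair_sign xy Y.
Definition pairs_supp P : seq T := flatten [seq [:: xy.1; xy.2] | xy <- P].

Lemma pairs_sign_cons xy P Y : pairs_sign (xy :: P) Y = pair_sign xy Y * pairs_sign P Y.
Proof. by rewrite /pairs_sign big_cons. Qed.

Definition exchange x y Y : {set T} := [set z | tperm x y z \in Y].

Lemma exchangeK x y : involutive (exchange x y).
Proof. by move=> Y; apply/setP=> z; rewrite !inE tpermK. Qed.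

Lemma exchangeC x y Y : exchange x y Y = exchange y x Y.
Proof. by apply/setP=> z; rewrite !inE tpermC. Qed.

Lemma card_exchange x y Y : #|exchange x y Y| = #|Y|.
Proof.
have <- : tperm x y @^-1: Y = exchange x y Y by apply/setP=> z; rewrite !inE.
exact/card_preimset/perm_inj.
Qed.

Lemma exchangeD x y X Y : exchange x y (X :\: Y) = exchange x y X :\: exchange x y Y.
Proof. by apply/setP=> z; rewrite !inE. Qed.

Lemma exchange_id x y X : (x \in X) = (y \in X) -> exchange x y X = X.
Proof. by move=> h; apply/setP=> z; rewrite inE; case: tpermP => [->|->|]. Qed.

Lemma exchangeI_id x y Y W : x \notin W -> y \notin W -> exchange x y Y :&: W = Y :&: W.
Proof.
move=> xW yW; apply/setP=> z; rewrite !inE andbC [RHS]andbC.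
case zW: (z \in W) => //=; rewrite tpermD //.
  by apply: contraNneq xW => ->.
by apply: contraNneq yW => ->.
Qed.

Lemma pair_sign_exchange x y Y : pair_sign (x, y) (exchange x y Y) = - pair_sign (x, y) Y.
Proof. by rewrite /pair_sign /= !inE tpermL tpermR opprB. Qed.

Lemma pairs_sign_exchange x y P Y :
  x \notin pairs_supp P -> y \notin pairs_supp P ->
  pairs_sign P (exchange x y Y) = pairs_sign P Y.
Proof.
rewrite /pairs_sign; elim: P => [|[a b] P IH]; first by rewrite !big_nil.
rewrite /= !inE !negb_or => /and3P[xa xb xP] /and3P[ya yb yP].
by rewrite !big_cons IH // /pair_sign /= !inE !tpermD.
Qed.

(** Exchanging the two points of a pair changes the sign of the summand, so a
    range of summation that is stable under the exchange gives 0. *)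
Lemma exchange_sum_eq0 x y P (Q : pred {set T}) :
  x \notin pairs_supp P -> y \notin pairs_supp P ->
  (forall Y, Q (exchange x y Y) = Q Y) ->
  \sum_(Y | Q Y) pairs_sign ((x, y) :: P) Y = 0.
Proof.
move=> xP yP QE; set s := LHS.
suff : s = - s by lia.
rewrite /s [LHS](reindex_inj (inv_inj (exchangeK x y))) /= -sumrN.
rewrite (eq_bigl Q) //; apply: eq_bigr => Y _.
by rewrite !pairs_sign_cons pair_sign_exchange pairs_sign_exchange // mulNr.
Qed.

Lemma card_exchange_cross x y X Y : x \in X -> y \notin X -> x \in Y -> y \notin Y ->
  (#|X :\: exchange x y Y| = #|X :\: Y|.+1) * (#|exchange x y Y :\: X| = #|Y :\: X|.+1).
Proof.
move=> xX yX xY yY; split.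
  have -> : X :\: exchange x y Y = x |: (X :\: Y).
    apply/setP=> z; rewrite !inE; case: tpermP => [->|->|/eqP zx /eqP zy].
    - by rewrite yY xX eqxx.
    - by rewrite (negbTE yX) !andbF orbF; case: eqP yX => // ->; rewrite xX.
    - by rewrite (negbTE zx).
  by rewrite cardsU1 !inE xY.
have -> : exchange x y Y :\: X = y |: (Y :\: X).
  apply/setP=> z; rewrite !inE; case: tpermP => [->|->|/eqP zx /eqP zy].
  - by rewrite (negbTE yY) xX andbF /= orbF; case: eqP yX => // <-; rewrite xX.
  - by rewrite xY yX eqxx.
  - by rewrite (negbTE zy).
by rewrite cardsU1 !inE (negbTE yY) andbF.
Qed.

Definition agree Y X W := Y :&: W == X :&: W.

Lemma card_layer W X i :
  #|[set Y | agree Y X W && ((#|X :\: Y| == i) && (#|Y :\: X| == i))]|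
  = ('C(#|X :\: W|, i) * 'C(#|~: X :\: W|, i))%N.
Proof.
have -> : [set Y | agree Y X W && ((#|X :\: Y| == i) && (#|Y :\: X| == i))] =
  [set Y : {set T} | ((X :\: Y \subset ~: W) && (#|X :\: Y| == i)) &&
           ((Y :\: X \subset ~: W) && (#|Y :\: X| == i))].
  apply/setP=> Y; rewrite !inE andbACA; congr (_ && _).
  apply/eqP/andP => [/setP h|[/subsetP h1 /subsetP h2]].
    by split; apply/subsetP=> z; have := h z; rewrite !inE; case: (z \in W); case: (z \in X); case: (z \in Y).
  apply/setP=> z; have := h1 z; have := h2 z; rewrite !inE.
  by case: (z \in W); case: (z \in X); case: (z \in Y) => //= a b; (have := a isT) || (have := b isT).
rewrite (card_set_flip X (fun I : {set T} => (I \subset ~: W) && (#|I| == i))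
   (fun I : {set T} => (I \subset ~: W) && (#|I| == i))).
by rewrite -!cards_draws; congr (_ * _)%N; apply: eq_card => I;
  rewrite !inE andbA setDE subsetI.
Qed.

Lemma agreeU Y X W1 W2 : agree Y X (W1 :|: W2) = agree Y X W1 && agree Y X W2.
Proof.
rewrite /agree !setIUr; apply/eqP/andP => [/setP h|[/eqP -> /eqP ->] //].
split; apply/eqP/setP=> z; have := h z; rewrite !inE;
  by case: (z \in W1); case: (z \in W2); case: (z \in X); case: (z \in Y).
Qed.

Lemma agree2E Y X x y :
  agree Y X [set x; y] = ((x \in Y) == (x \in X)) && ((y \in Y) == (y \in X)).
Proof.
apply/eqP/andP => [/setP h|[/eqP hx /eqP hy]].
  by have := h x; have := h y; rewrite !inE !eqxx orbT !andbT => -> ->.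
by apply/setP=> z; rewrite !inE; case: eqP => [->|_]; rewrite ?hx //; case: eqP => [->|_]; rewrite ?hy ?andbF.
Qed.

Lemma card_exchange_layer x y X Y : (x \in X) != (y \in X) -> agree Y X [set x; y] ->
  (#|X :\: exchange x y Y| = #|X :\: Y|.+1) * (#|exchange x y Y :\: X| = #|Y :\: X|.+1).
Proof.
rewrite agree2E => neX /andP[/eqP hx /eqP hy].
case xX: (x \in X) neX hx => /=; case yX: (y \in X) hy => //= hy _ hx.
  by apply: card_exchange_cross; rewrite ?xX ?yX ?hx ?hy.
rewrite exchangeC.
by apply: card_exchange_cross; rewrite ?xX ?yX ?hx ?hy.
Qed.

Lemma card_setD_pair x y X W k : x != y -> (x \in X) != (y \in X) ->
    x \notin W -> y \notin W -> #|X :\: W| = k.+1 ->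
  #|X :\: ([set x; y] :|: W)| = k.
Proof.
move=> nexy neX xW yW; rewrite setUC -setDDl.
have -> : (X :\: W) :\: [set x; y] = (X :\: W) :\ (if x \in X then x else y).
  apply/setP=> z; rewrite !inE.
  have [->|zx] := eqVneq z x.
    by move: neX; case: (x \in X) => /=; rewrite ?eqxx ?andbF.
  have [->|zy] := eqVneq z y; last by case: ifP => _; rewrite ?zx ?zy.
  by move: neX; case: (x \in X) => /=; case: (y \in X); rewrite ?eqxx ?andbF.
rewrite (cardsD1 (if x \in X then x else y)).
suff -> : (if x \in X then x else y) \in X :\: W by case.
by move: neX; case xX: (x \in X) => /=; rewrite inE ?xX ?xW //; case: (y \in X); rewrite ?yW.
Qed.

(** The signs on the sets that agree with [X] on [W] and lie at distance [i] from
    it.  If [X] contains both or none of the points of the first pair, both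
    sides vanish.  Otherwise a set with nonzero sign either agrees with [X] on
    this pair or is the exchange of such a set, one step further away and with
    the opposite sign. *)
Lemma pairs_sign_layer X P W a b i :
    uniq (pairs_supp P) -> all (fun z => z \notin W) (pairs_supp P) ->
    #|X :\: W| = (a + size P)%N -> #|~: X :\: W| = (b + size P)%N ->
  \sum_(Y | agree Y X W && ((#|X :\: Y| == i) && (#|Y :\: X| == i))) pairs_sign P Y
  = pairs_sign P X * layer_value a b (size P) i.
Proof.
elim: P W i => [|[x y] P IH] W i /=.
  move=> _ _; rewrite !addn0 => <- <-; rewrite -card_layer /pairs_sign big_nil mul1r.
  rewrite (eq_bigr (fun _ => 1)) => [|Y _]; last by rewrite big_nil.
  rewrite sumr_const; rewrite -[RHS]natz; congr (_ *+ _); apply: eq_card => Y; by rewrite inE.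
rewrite inE negb_or => /andP[/andP[nexy xP] /andP[yP uP]] /and3P[xW yW allW] cX cX'.
rewrite [pairs_sign _ X]pairs_sign_cons.
have [eqX|neX] := eqVneq (x \in X) (y \in X).
  rewrite /pair_sign /= eqX subrr !mul0r; apply: exchange_sum_eq0 => // Y.
  rewrite /agree exchangeI_id //.
  by rewrite -{2 3}(exchange_id eqX) -!exchangeD !card_exchange.
pose A Y := agree Y X [set x; y].
(* [Y] agrees with [X] on the pair, or is opposite to it, or has sign 0 *)
have signE Y : pair_sign (x, y) Y =
    pair_sign (x, y) X * ((A Y)%:Z - (A (exchange x y Y))%:Z).
  rewrite /A /= !agree2E !inE tpermL tpermR /pair_sign /=; move: neX.
  by case: (x \in X); case: (y \in X); case: (x \in Y); case: (y \in Y).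
pose Q (W' : {set T}) j Y := agree Y X W' && ((#|X :\: Y| == j) && (#|Y :\: X| == j)).
have agreeE j Y : Q W j Y && A Y = Q ([set x; y] :|: W) j Y.
  by rewrite /Q agreeU /A andbC andbA.
have first j : \sum_(Y | Q W j Y) (A Y)%:Z * pairs_sign P Y =
    pairs_sign P X * layer_value a b (size P) j.
  rewrite -(IH ([set x; y] :|: W)) //.
  - rewrite [RHS](eq_bigl (fun Y => Q W j Y && A Y)) => [|Y]; last exact/esym/agreeE.
    rewrite [RHS]big_mkcondr /=; apply: eq_bigr => Y _.
    by case: (A Y); rewrite ?mul1r ?mul0r.
  - apply/allP=> z zP; rewrite !inE !negb_or (allP allW z zP) andbT.
    by apply/andP; split; [apply: contraNneq xP => <-|apply: contraNneq yP => <-].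
  - by apply: card_setD_pair => //; rewrite cX addnS.
  by apply: card_setD_pair => //; rewrite ?inE ?cX' ?addnS //; case: (x \in X) neX; case: (y \in X).
have second : \sum_(Y | Q W i Y) (A (exchange x y Y))%:Z * pairs_sign P Y =
    pairs_sign P X * (if i is i'.+1 then layer_value a b (size P) i' else 0).
  rewrite (reindex_inj (inv_inj (exchangeK x y))) /=.
  have QE Y : A Y -> Q W i (exchange x y Y) = if i is i'.+1 then Q W i' Y else false.
    move=> AY; rewrite /Q /agree exchangeI_id // !(card_exchange_layer neX AY).
    by case: (i) => [|i']; rewrite ?andbF // !eqSS.
  transitivity (\sum_(Y | if i is i'.+1 then Q W i' Y else false) (A Y)%:Z * pairs_sign P Y).
    rewrite big_mkcond [RHS]big_mkcond; apply: eq_bigr => Y _.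
    rewrite exchangeK pairs_sign_exchange //; case AY: (A Y); first by rewrite QE.
    by rewrite mul0r !if_same.
  by case: (i) => [|i']; [rewrite big_pred0 ?mulr0 | exact: first].
rewrite -mulrA mulrBr -first -second -sumrB mulr_sumr; apply: eq_bigr => Y _.
by rewrite -mulrBl mulrA -signE pairs_sign_cons.
Qed.

(** Signed sums over balls: [pairs_sign] is an eigenvector.  The sum over the
    distances up to [e] telescopes because of the recursion in [layer_value],
    which removes one pair. *)
Lemma pairs_sign_ball X xy P a b e :
    uniq (pairs_supp (xy :: P)) ->
    #|X| = (a + size P).+1 -> #|~: X| = (b + size P).+1 ->
  \sum_(Y : {set T} | (#|Y| == #|X|) && (#|X :\: Y| <= e)%N) pairs_sign (xy :: P) Y
  = pairs_sign (xy :: P) X * layer_value a b (size P) e.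
Proof.
move=> uP cX cX'.
have layer i := @pairs_sign_layer X (xy :: P) set0 a b i uP.
have {}layer i : \sum_(Y | (#|X :\: Y| == i) && (#|Y :\: X| == i)) pairs_sign (xy :: P) Y
  = pairs_sign (xy :: P) X * layer_value a b (size P).+1 i.
  rewrite -layer ?setD0 ?addnS //; last by apply/allP=> z _; rewrite inE.
  by apply: eq_bigl => Y; rewrite /agree !setI0 eqxx.
elim: e => [|e IH].
  have := layer 0; rewrite /= subr0 => <-; apply: eq_bigl => Y.
  rewrite eq_sym eq_card_setD leqn0; lia.
rewrite (bigID (fun Y => #|X :\: Y| <= e)%N) /=.
rewrite (eq_bigl (fun Y : {set T} => (#|Y| == #|X|) && (#|X :\: Y| <= e)%N)); last by move=> Y; lia.
rewrite IH [X in _ + X](eq_bigl (fun Y => (#|X :\: Y| == e.+1) && (#|Y :\: X| == e.+1))).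
  by rewrite layer /=; lia.
by move=> Y; rewrite [#|Y| == _]eq_sym eq_card_setD; lia.
Qed.

End Pairs.

Lemma count_pairs_supp (T : finType) (P : seq (T * T)) (X : {set T}) :
  pairs_sign P X != 0 -> count (mem X) (pairs_supp P) = size P.
Proof.
elim: P => [//|[x y] P IH]; rewrite pairs_sign_cons mulf_eq0 negb_or /= => /andP[h /IH ->].
by move: h; rewrite /pair_sign /=; case: (x \in X); case: (y \in X).
Qed.

Lemma card_setI_seq (T : finType) (s : seq T) (X : {set T}) :
  uniq s -> #|X :&: [set z in s]| = count (mem X) s.
Proof.
move=> us; rewrite -size_filter -(card_uniqP (filter_uniq _ us)).
by apply: eq_card => z; rewrite !inE mem_filter.
Qed.

Definition ball_size w w' e : nat := (\sum_(i < e.+1) 'C(w, i) * 'C(w', i))%N.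

Lemma card_ball (T : finType) (X : {set T}) e :
  #|[set Y : {set T} | (#|Y| == #|X|) && (#|X :\: Y| <= e)%N]| = ball_size #|X| #|~: X| e.
Proof.
have layer i : #|[set Y : {set T} | (#|X :\: Y| == i) && (#|Y :\: X| == i)]|
  = ('C(#|X|, i) * 'C(#|~: X|, i))%N.
  have := card_layer set0 X i; rewrite !setD0 => <-.
  by apply: eq_card => Y; rewrite !inE /agree !setI0 eqxx.
rewrite /ball_size; elim: e => [|e IH].
  rewrite big_ord_recr big_ord0 /= add0n -layer; apply: eq_card => Y.
  rewrite !inE eq_sym eq_card_setD; lia.
rewrite big_ord_recr /= -IH -layer -cardsUI.
rewrite [X in (_ + X)%N](_ : _ = 0%N) ?addn0; last first.
  by apply: eq_card0 => Y; rewrite !inE; lia.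
by apply: eq_card => Y; rewrite !inE [#|Y| == _]eq_sym eq_card_setD; lia.
Qed.

Section Design.
Variables (n w e t : nat) (C : {set {set 'I_n}}).
Hypothesis perfC : perfect_code w e C.
Hypotheses (le_wn : (w <= n)%N) (le_tw : (t <= w)%N) (le_tw' : (t <= n - w)%N).
Hypothesis layer_neq0 : forall k, (k < t)%N ->
  layer_value (w - k.+1) (n - w - k.+1) k e != 0.
Implicit Types (X Y S : {set 'I_n}) (P : seq ('I_n * 'I_n)).

(** The sum of the signs over all words is 0; summing over balls instead
    multiplies the sum over the code by a nonzero eigenvalue. *)
Lemma perfect_pairs_sum P : uniq (pairs_supp P) -> (0 < size P <= t)%N ->
  \sum_(X in C) pairs_sign P X = 0.
Proof.
case: P => [//|[x y] P] uP /andP[_ lePt].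
have [xP yP] : x \notin pairs_supp P /\ y \notin pairs_supp P.
  by move: uP; rewrite /= inE negb_or -andbA => /and4P[_ -> -> _].
have := @exchange_sum_eq0 _ x y P (fun Y => #|Y| == w) xP yP.
rewrite (perfect_big perfC +%R) => h.
apply/eqP; have := layer_neq0 lePt.
suff : (\sum_(X in C) pairs_sign ((x, y) :: P) X) *
  layer_value (w - (size P).+1) (n - w - (size P).+1) (size P) e == 0.
  by rewrite mulf_eq0 => /orP[//|->].
rewrite mulr_suml -[X in _ == X]h; last by move=> Y; rewrite card_exchange.
apply/eqP/eq_bigr => X XC; have cX := perfect_card perfC XC.
rewrite -[in RHS]cX.
rewrite (@pairs_sign_ball _ X (x, y) P (w - (size P).+1) (n - w - (size P).+1)) //.
  by rewrite cX; move: lePt => /=; lia.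
by rewrite cardsCs setCK card_ord cX; move: lePt => /=; lia.
Qed.

Lemma sumr_over (S : {set 'I_n}) (z : 'I_n) (f : {set 'I_n} -> int) :
  \sum_(X in C | (z |: S) \subset X) f X =
  \sum_(X in C | S \subset X) (z \in X)%:Z * f X.
Proof.
rewrite big_mkcond [RHS]big_mkcond /=; apply: eq_bigr => X _.
rewrite subUset sub1set; case: (X \in C) => //=; case: (z \in X) => /=.
  by rewrite mul1r.
by rewrite mul0r if_same.
Qed.

Lemma sum_sumr_over (S : {set 'I_n}) (D : pred 'I_n) (f : {set 'I_n} -> int) :
  \sum_(z | D z) \sum_(X in C | (z |: S) \subset X) f X =
  \sum_(X in C | S \subset X) #|[set z in X | D z]|%:Z * f X.
Proof.
under eq_bigr do rewrite sumr_over.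
rewrite exchange_big /=; apply: eq_bigr => X _; rewrite -mulr_suml; congr (_ * _).
rewrite -sum1_card big_mkcond [in RHS]big_mkcond /= -natz natr_sum.
apply: eq_bigr => z _; rewrite inE.
by case: (D z); case: (z \in X).
Qed.

(** Extends the vanishing to the codewords that contain a fixed set.  By
    induction, replacing a point [s] of [S] by any other free point [z] does not
    change the sum, the difference being the sum with the additional pair
    [(z, s)].  The average over [z] is a multiple of the sum over [S :\ s],
    which is 0. *)
Lemma perfect_pairs_sum_over S P : uniq (pairs_supp P) ->
    {in S, forall z, z \notin pairs_supp P} -> (0 < size P)%N -> (#|S| + size P <= t)%N ->
  \sum_(X in C | S \subset X) pairs_sign P X = 0.
Proof.
have [m] := ubnP #|S|; elim: m S P => // m IH S P ltSm uP SP P_gt0 leSt.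
have [->|[s sS]] := set_0Vmem S.
  under eq_bigl do rewrite sub0set andbT.
  by apply: perfect_pairs_sum; rewrite // P_gt0; lia.
pose S0 := S :\ s; have eS : s |: S0 = S by rewrite setD1K.
have cS : #|S| = #|S0|.+1 by rewrite (cardsD1 s) sS.
pose D z := (z \notin S0) && (z \notin pairs_supp P).
have Ds : D s by rewrite /D SP // !inE eqxx.
have S0P : {in S0, forall z, z \notin pairs_supp P}.
  by move=> z; rewrite inE => /andP[_ /SP].
pose G z := \sum_(X in C | (z |: S0) \subset X) pairs_sign P X.
have G0 : \sum_(X in C | S0 \subset X) pairs_sign P X = 0 by apply: IH => //; lia.
have GE z : D z -> G z = G s.
  have [-> //|nezs] := eqVneq z s; case/andP=> zS zP.
  have : \sum_(X in C | S0 \subset X) pairs_sign ((z, s) :: P) X = 0.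
    apply: IH => //.
    - by rewrite -ltnS -cS.
    - by rewrite /= inE negb_or nezs zP SP.
    2: by move: leSt; rewrite cS addSnnS.
    move=> y yS0; rewrite !inE !negb_or (S0P y yS0) andbT /=.
    apply/andP; split; first by apply: contraNneq zS => <-.
    by move: yS0; rewrite !inE => /andP[].
  under eq_bigr do rewrite pairs_sign_cons /pair_sign /= mulrBl.
  by rewrite sumrB -!sumr_over => /eqP; rewrite subr_eq0 => /eqP.
have : \sum_(z | D z) G z = 0.
  rewrite sum_sumr_over -[RHS](mulr0 (w - #|S0| - size P)%N%:Z) -[in RHS]G0 mulr_sumr.
  apply: eq_bigr => X /andP[XC sX].
  have [->|nz] := eqVneq (pairs_sign P X) 0; first by rewrite !mulr0.
  congr (_%:Z * _).
  have -> : [set z in X | D z] = X :\: (S0 :|: [set z in pairs_supp P]).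
    by apply/setP=> z; rewrite /D !inE negb_or andbC.
  rewrite cardsD setIUr cardsU (setIidPr sX) (card_setI_seq _ uP) count_pairs_supp //.
  rewrite (_ : S0 :&: _ = set0) ?cards0.
    rewrite (perfect_card perfC XC). by rewrite subn0 subnDA.
  apply/setP=> z; rewrite !inE; apply/negP => /andP[/andP[zS z1] /andP[_ z2]].
  by move: (S0P z); rewrite !inE zS z1 z2 => /(_ isT).
rewrite (eq_bigr (fun _ => G s)) // sumr_const => /eqP.
rewrite mulrn_eq0 => /orP[|/eqP]; last by rewrite /G eS.
by move/eqP/card0_eq/(_ s); rewrite [s \in _]Ds.
Qed.

(** A perfect code is a design: by the vanishing for a single pair, the number of
    codewords over [S] does not change when a point of [S] is moved, so it is an
    average. *)
Lemma perfect_design S : (#|S| <= t)%N ->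
  (#|[set X in C | S \subset X]| * 'C(n, #|S|) = 'C(w, #|S|) * #|C|)%N.
Proof.
pose cnt S' := #|[set X in C | S' \subset X]|.
have cntE S' : (cnt S')%:Z = \sum_(X in C | S' \subset X) pairs_sign [::] X.
  rewrite (eq_bigr (fun _ => 1)) => [|X _]; last by rewrite /pairs_sign big_nil.
  by rewrite sumr_const natz /cnt; congr (_%:Z); apply: eq_card => X; rewrite inE.
have [m] := ubnP #|S|; elim: m S => // m IH S ltSm leSt.
have [->|[s sS]] := set_0Vmem S.
  rewrite cards0 !bin0 mul1n muln1; apply: eq_card => X; by rewrite inE sub0set andbT.
pose S0 := S :\ s; have eS : s |: S0 = S by rewrite setD1K.
have cS : #|S| = #|S0|.+1 by rewrite (cardsD1 s) sS.
have cntC z : z \notin S0 -> cnt (z |: S0) = cnt S.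
  move=> zS0; have [->|nezs] := eqVneq z s; first by rewrite eS.
  have : \sum_(X in C | S0 \subset X) pairs_sign [:: (z, s)] X = 0.
    apply: perfect_pairs_sum_over => //=.
    - by rewrite inE nezs.
    2: by rewrite addn1 -cS.
    move=> y yS0; rewrite !inE negb_or /=; apply/andP; split.
      by apply: contraNneq zS0 => <-.
    by move: yS0; rewrite !inE => /andP[].
  under eq_bigr do rewrite pairs_sign_cons /pair_sign /= mulrBl.
  by rewrite sumrB -!sumr_over -!cntE eS => /eqP; rewrite subr_eq0 => /eqP[].
have key : ((n - #|S0|) * cnt S = (w - #|S0|) * cnt S0)%N.
  suff : ((n - #|S0|) * cnt S)%N%:Z = ((w - #|S0|) * cnt S0)%N%:Z by case.
  have -> : (n - #|S0|)%N = #|[pred z | z \notin S0]|.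
    have -> : #|[pred z | z \notin S0]| = #|~: S0| by apply: eq_card => z; rewrite !inE.
    by rewrite [RHS]cardsCs setCK card_ord.
  transitivity (\sum_(z | z \notin S0) \sum_(X in C | (z |: S0) \subset X) pairs_sign [::] X).
    under [RHS]eq_bigr => z zS0 do rewrite -cntE cntC //.
    by rewrite sumr_const PoszM -mulr_natl natz.
  rewrite sum_sumr_over PoszM cntE mulr_sumr; apply: eq_bigr => X /andP[XC sX].
  congr (_%:Z * _); rewrite -(perfect_card perfC XC) -(cardsDS sX).
  by apply: eq_card => z; rewrite !inE andbC.
have := IH S0 ltac:(lia) ltac:(lia).
have h1 := mul_bin_left n #|S0|; have h2 := mul_bin_left w #|S0|.
rewrite -/(cnt _) -/(cnt S0) cS => h.
apply/eqP; rewrite -(eqn_pmul2l (ltn0Sn #|S0|)); apply/eqP.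
rewrite [LHS]mulnCA h1 [RHS]mulnA h2 -[RHS]mulnA -h.
by rewrite [LHS]mulnA [(cnt S * _)%N]mulnC key -mulnA.
Qed.

Lemma perfect_card_ball : (#|C| * ball_size w (n - w) e = 'C(n, w))%N.
Proof.
rewrite -[in RHS](card_ord n) -cardsT -cards_draws -sum_nat_const.
transitivity #|[set Y : {set 'I_n} | #|Y| == w]|; last first.
  by apply: eq_card => Y; rewrite !inE subsetT.
rewrite (perfect_count perfC (P := fun Y => #|Y| == w)) => [|Y /eqP //].
apply: eq_bigr => X XC; have cX := perfect_card perfC XC.
have cXc : #|~: X| = (n - w)%N by rewrite cardsCs setCK card_ord cX.
by rewrite -cXc -{1}cX -card_ball cX.
Qed.

(** The quotient is the number of codewords over a fixed [t]-set. *)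
Lemma perfect_design_dvd : (ball_size w (n - w) e %| 'C(n - t, w - t))%N.
Proof.
have [S _ cS] : exists2 S : {set 'I_n}, S \subset setT & #|S| = t.
  by apply: exists_subset; rewrite cardsT card_ord; lia.
apply/dvdnP; exists #|[set X in C | S \subset X]|; apply/eqP.
have c_gt0 : (0 < 'C(n, t))%N by rewrite bin_gt0; lia.
have h := perfect_design (S := S); rewrite cS in h.
have trinomial : ('C(n, t) * 'C(n - t, w - t) = 'C(n, w) * 'C(w, t))%N.
  have f_gt0 : (0 < t`! * (w - t)`! * (n - w)`!)%N by rewrite !muln_gt0 !fact_gt0.
  apply/eqP; rewrite -(eqn_pmul2r f_gt0); apply/eqP.
  have h1 := bin_fact le_wn; have h2 := bin_fact le_tw.
  have h3 : ('C(n, t) * (t`! * (n - t)`!) = n`!)%N by apply: bin_fact; lia.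
  have h4 : ('C(n - t, w - t) * ((w - t)`! * (n - w)`!) = (n - t)`!)%N.
    by rewrite (_ : n - w = n - t - (w - t))%N ?bin_fact; lia.
  transitivity n`!; [rewrite -h3 -h4 | rewrite -h1 -h2]; lia.
rewrite -(eqn_pmul2l c_gt0) trinomial -perfect_card_ball mulnA [('C(n, t) * _)%N]mulnC h //.
by rewrite mulnAC [('C(w, t) * _)%N]mulnC.
Qed.

End Design.

End SignedCounting.

(** * Carries and divisibility of the ball size *)

Lemma logn_fact_widen p n M : prime p -> n < M ->
  logn p n`! = \sum_(1 <= i < M) n %/ p ^ i.
Proof.
move=> p_pr ltnM; rewrite logn_fact // [RHS](big_cat_nat _ (n := n.+1)) //=.
rewrite [X in _ + X]big1_seq ?addn0 // => i; rewrite mem_index_iota => /andP[_ /andP[lti _]].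
by rewrite divn_small // (leq_ltn_trans _ (ltn_expl _ (prime_gt1 p_pr))) // ltnW.
Qed.

(** A carry out of the [i] lowest base-[p] digits in the addition of [a] and
    [b]. *)
Definition carry p a b i : bool := p ^ i <= a %% p ^ i + b %% p ^ i.

(** Kummer's theorem. *)
Lemma logn_bin_carries p a b M : prime p -> a + b < M ->
  logn p 'C(a + b, a) = \sum_(1 <= i < M) carry p a b i.
Proof.
move=> p_pr ltM; have p_gt0 := prime_gt0 p_pr.
have h : 'C(a + b, a) * (a`! * b`!) = (a + b)`!.
  by rewrite -{2}(addKn a b) bin_fact ?leq_addr.
move/(congr1 (logn p)): h; rewrite !lognM ?muln_gt0 ?fact_gt0 ?bin_gt0 ?leq_addr //.
rewrite !(logn_fact_widen (M := M)) //; try lia.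
have -> : \sum_(1 <= i < M) (a + b) %/ p ^ i = \sum_(1 <= i < M) carry p a b i +
    (\sum_(1 <= i < M) a %/ p ^ i + \sum_(1 <= i < M) b %/ p ^ i).
  rewrite -!big_split /=; apply: eq_bigr => i _.
  by rewrite divnD ?expn_gt0 ?p_gt0 // addnC.
by move/addIn.
Qed.

(** Since [p ^ k] divides [e + g], the addition of [g] and [e] carries at every
    level up to [k] above the valuation of [g], and below it nothing can carry.  If the addition of [g] and [b]
    did not carry at level [k], it would not carry at any higher level either,
    because [g < p ^ k], and would have fewer carries in all. *)
Lemma carry_bin_dvd p e g b k : prime p -> 0 < k -> 0 < g < p ^ k -> p ^ k %| e + g ->
  'C(e + g, g) %| 'C(b + g, g) -> carry p g b k.
Proof.
move=> p_pr k_gt0 /andP[g_gt0 lt_g] dvd_eg dvdC; apply/idPn => ncb.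
have p_gt0 := prime_gt0 p_pr.
have pi_gt0 i : 0 < p ^ i by rewrite expn_gt0 p_gt0.
have := dvdn_leq_log p _ dvdC; rewrite bin_gt0 leq_addl => /(_ isT).
pose M := (e + g + b + k).+1.
rewrite ![_ + g]addnC !(logn_bin_carries (M := M)) /M //; try lia.
apply/negP; rewrite -ltnNge.
(* level by level the second addition carries at most as often as the first *)
have le_carry i : 0 < i -> carry p g b i <= carry p g e i.
  move=> i_gt0; case: (leqP k i) => [le_ki|lt_ik].
    suff -> : carry p g b i = false by [].
    apply/negbTE; move: ncb; rewrite /carry -!ltnNge !(modn_small lt_g) => h.
    have le_pk : p ^ k <= p ^ i by rewrite leq_exp2l // prime_gt1.
    rewrite (modn_small (leq_trans lt_g le_pk)).
    have dvd_ki : p ^ k %| p ^ i by rewrite dvdn_exp2l.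
    have lt_b := ltn_pmod b (pi_gt0 i).
    have e1 := modn_dvdm b dvd_ki; have e2 := divn_eq (b %% p ^ i) (p ^ k).
    rewrite e1 in e2; move: (b %% p ^ i) (b %% p ^ i %/ p ^ k) e2 lt_b => _ d -> lt_b.
    case/dvdnP: dvd_ki => c ec; rewrite ec in lt_b *.
    have lt_dc : d < c.
      by rewrite -(ltn_pmul2r (pi_gt0 k)); apply: leq_ltn_trans lt_b; apply: leq_addr.
    apply: (@leq_trans (d.+1 * p ^ k)); last by rewrite leq_mul2r lt_dc orbT.
    by rewrite mulSn addnCA addnC ltn_add2r.
  case: (posnP (g %% p ^ i)) => [g0|gi_gt0].
    suff -> : carry p g b i = false by [].
    by apply/negbTE; rewrite /carry g0 add0n -ltnNge ltn_pmod.
  suff -> : carry p g e i = true by case: (carry _ _ _ _).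
  have : p ^ i %| e + g by apply: dvdn_trans dvd_eg; rewrite dvdn_exp2l // ltnW.
  rewrite /carry /dvdn -modnDm => h; rewrite leqNgt; apply/negP=> lt_s.
  by move: h; rewrite modn_small addnC //; lia.
have ck : carry p g e k.
  move: dvd_eg; rewrite /carry /dvdn -modnDm (modn_small lt_g) => h.
  rewrite leqNgt; apply/negP=> lt_s.
  by move: h; rewrite modn_small addnC //; lia.
have kM : k \in index_iota 1 (e + g + b + k).+1 by rewrite mem_index_iota; lia.
rewrite (bigD1_seq k) ?iota_uniq //= [ltnRHS](bigD1_seq k) ?iota_uniq //= ck (negbTE ncb).
rewrite add0n add1n ltnS big_seq_cond [leqRHS]big_seq_cond; apply: leq_sum => i.
by rewrite mem_index_iota => /andP[/andP[i_gt0 _] _]; apply: le_carry.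
Qed.

Lemma carries_dvd_bin p a b j m : prime p -> 0 < j ->
  (forall i, j <= i < j + m -> carry p a b i) -> p ^ m %| 'C(a + b, a).
Proof.
move=> p_pr j_gt0 hc; rewrite pfactor_dvdn ?bin_gt0 ?leq_addr //.
rewrite (logn_bin_carries (M := a + b + j + m + 1)) //; last by lia.
rewrite (big_cat_nat _ (n := j)) //=; last by lia.
rewrite [X in _ + X](big_cat_nat _ (n := j + m)) //=; try lia.
rewrite addnCA; apply: leq_trans (leq_addr _ _).
rewrite (eq_big_nat _ _ (F2 := fun _ => 1)) => [|i hi]; last by rewrite hc.
by rewrite sum_nat_const_nat; lia.
Qed.

(** The [s] low digits of [m] are 0, so a carry can only leave digit [s], and
    there is no room for it to propagate beyond digit [s.+1]. *)
Lemma logn_bin_le1 p m m' s : prime p -> p ^ s %| m -> m < p ^ s.+1 -> m + m' < p ^ s.+2 ->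
  logn p 'C(m + m', m) <= 1.
Proof.
move=> p_pr dvd_m lt_m lt_mm'; have p_gt1 := prime_gt1 p_pr.
have pi_gt0 i : 0 < p ^ i by rewrite expn_gt0 prime_gt0.
rewrite (logn_bin_carries (M := (m + m').+1)) //.
apply: (@leq_trans (\sum_(1 <= i < (m + m').+1) (i == s.+1))).
  apply: leq_sum => i _; case: (ltngtP i s.+1) => [lt_is|lt_si|_]; last exact: leq_b1.
    have h : p ^ i %| m by apply: dvdn_trans dvd_m; rewrite dvdn_exp2l.
    suff -> : carry p m m' i = false by [].
    by apply/negbTE; rewrite /carry (eqP h) add0n -ltnNge ltn_pmod.
  have le_p : p ^ s.+2 <= p ^ i by rewrite leq_exp2l.
  by rewrite /carry !modn_small; lia.
have -> : \sum_(1 <= i < (m + m').+1) (i == s.+1) =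
          \sum_(1 <= i < (m + m').+1 | i == s.+1) 1.
  by rewrite [RHS]big_mkcond; apply: eq_bigr => i _; case: eqP.
rewrite sum1_count.
by rewrite (count_uniq_mem _ (iota_uniq _ _)); case: (_ \in _).
Qed.

Lemma prime_power_dvd_bin p k j M b : prime p -> p ^ (k + j) %| M -> ~~ (p ^ j.+1 %| b) ->
  p ^ k %| 'C(M, b).
Proof.
move=> p_pr dvdM ndb.
have [lt_Mb|le_bM] := ltnP M b; first by rewrite bin_small.
case: b => [|b] in ndb le_bM *; first by rewrite dvdn0 in ndb.
have M_gt0 : 0 < M by case: M le_bM {dvdM}.
have := mul_bin_diag M b => /esym h.
have : p ^ (k + j) %| b.+1 * 'C(M, b.+1) by rewrite h dvdn_mulr.
rewrite !pfactor_dvdn ?muln_gt0 ?bin_gt0 //= lognM ?bin_gt0 //.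
move: ndb; rewrite pfactor_dvdn //; lia.
Qed.

(** Coefficients of [x^a * (1 + x)^m]; the shift makes Vandermonde's identity
    applicable inside the truncated convolution [shift_conv], which for zero
    shifts is the size of a ball. *)
Definition shift_bin m a i : nat := if a <= i then 'C(m, i - a) else 0.
Definition shift_conv m m' a a' e : nat :=
  \sum_(i < e.+1) shift_bin m a i * shift_bin m' a' i.

Lemma shift_binD M m a i e : i <= e ->
  shift_bin (M + m) a i = \sum_(b < e.+1) 'C(M, b) * shift_bin m (a + b) i.
Proof.
move=> le_ie; rewrite /shift_bin; case: (leqP a i) => [le_ai|lt_ia]; last first.
  by rewrite big1 // => b _; rewrite leqNgt (leq_trans lt_ia (leq_addr _ _)) muln0.
rewrite -binomial.Vandermonde.
rewrite -(big_mkord xpredT (fun b => 'C(M, b) * 'C(m, i - a - b))).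
rewrite -(big_mkord xpredT (fun b => 'C(M, b) * (if a + b <= i then 'C(m, i - (a + b)) else 0))).
rewrite [RHS](big_cat_nat _ (n := (i - a).+1)) //=; last by lia.
rewrite [X in _ = _ + X]big1_seq ?addn0.
  rewrite big_nat [RHS]big_nat; apply: eq_bigr => b /andP[_ le_b].
  by rewrite subnDA ifT //; lia.
move=> b; rewrite mem_index_iota => /andP[_ /andP[lt_b _]].
by rewrite ifF ?muln0 //; lia.
Qed.

Lemma shift_convD M M' m m' a a' e :
  shift_conv (M + m) (M' + m') a a' e =
  \sum_(b < e.+1) \sum_(b' < e.+1)
     'C(M, b) * 'C(M', b') * shift_conv m m' (a + b) (a' + b') e.
Proof.
rewrite /shift_conv.
under eq_bigr => i _.
  rewrite (@shift_binD M m a i e (ltn_ord i)) (@shift_binD M' m' a' i e (ltn_ord i)).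
  rewrite big_distrlr /=; over.
rewrite exchange_big; apply: eq_bigr => b _; rewrite exchange_big; apply: eq_bigr => b' _.
by rewrite big_distrr; apply: eq_bigr => i _; rewrite mulnACA.
Qed.

Lemma shift_conv_full m m' a e : a + m <= e -> shift_conv m m' a a e = 'C(m + m', m).
Proof.
move=> le_ame; rewrite /shift_conv.
rewrite -(big_mkord xpredT (fun i => shift_bin m a i * shift_bin m' a i)).
rewrite (big_cat_nat _ (n := a)) //=; last by lia.
rewrite big1_seq ?add0n; last first.
  by move=> i; rewrite mem_index_iota /shift_bin => /and3P[_ _ lt_ia]; rewrite leqNgt lt_ia.
rewrite -{1}(add0n a) big_addn (big_cat_nat _ (n := m.+1)) //=; last by lia.
rewrite [X in _ + X]big1_seq ?addn0; last first.
  move=> i; rewrite mem_index_iota /shift_bin => /and3P[_ lt_mi _].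
  by rewrite leq_addl addnK bin_small.
rewrite addnC -binomial.Vandermonde -(big_mkord xpredT (fun i => 'C(m', i) * 'C(m, m - i))).
rewrite big_nat [RHS]big_nat; apply: eq_bigr => i /andP[_ le_im].
by rewrite /shift_bin leq_addl addnK mulnC (@bin_sub m i le_im).
Qed.

(** For shifts by multiples of [q] and binomials of rank less than [q], the two
    factors have their supports in single blocks of length [q].  The truncation
    at [e], which ends [g] places before a multiple of [q], cuts at a point
    where a block has no support left, so the convolution is either empty or a
    complete Vandermonde sum. *)
Lemma shift_conv_block_dvd d q u u' g c c' e : 0 < u <= q -> 0 < u' -> 0 < g <= u -> g <= u' -> u' <= q ->
  q %| e + g -> d %| 'C((q - u) + (q - u'), q - u) ->
  d %| shift_conv (q - u) (q - u') (c * q) (c' * q) e.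
Proof.
move=> /andP[u_gt0 le_uq] u'_gt0 /andP[g_gt0 le_gu] le_gu' le_u'q /dvdnP[E eE] dvdd.
have in_block m b (i : nat) : m < q -> shift_bin m (b * q) i != 0 -> i %/ q = b.
  move=> ltmq; rewrite /shift_bin; case: ifP => // le_bi nz.
  have le_i : i - b * q <= m by rewrite leqNgt; apply: contraNN nz => /bin_small ->.
  have q_gt0 : 0 < q by lia.
  rewrite -(subnK le_bi) addnC divnMDl // divn_small ?addn0 //; lia.
have [<-|necc] := eqVneq c c'; last first.
  rewrite /shift_conv big1 // => i _; apply/eqP/idPn; rewrite muln_eq0 negb_or.
  move=> /andP[h h'].
  have e1 := in_block _ _ _ _ h; have e2 := in_block _ _ _ _ h'.
  by move: necc; rewrite -e1 -?e2 ?eqxx //; lia.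
have [le_Ec|lt_cE] := leqP E c.
  rewrite /shift_conv big1 // => i _; rewrite /shift_bin ifF //.
  have := ltn_ord i; have : E * q <= c * q by rewrite leq_mul2r le_Ec orbT.
  lia.
rewrite shift_conv_full //.
have : c.+1 * q <= E * q by rewrite leq_mul2r lt_cE orbT.
rewrite mulSn; lia.
Qed.

Section BallDivisible.
Variables (p k u u' g : nat).
Hypotheses (p_pr : prime p) (k_ge2 : 2 <= k).
Hypotheses (g_gt0 : 0 < g) (le_gu : g <= u) (le_gu' : g <= u') (le_uu' : u + u' <= p ^ k.-1).
Let q := p ^ k.-1.

(** The condition [u + u' <= p ^ k.-1] is used for the carry at level [k.-1]; the
    one at level [k] follows. *)
Lemma carry_block j : k.-1 <= j <= k -> carry p (p ^ k - u) (p ^ k - u') j.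
Proof.
move=> hj; have p_gt1 := prime_gt1 p_pr.
have le_q : q <= p ^ j by rewrite leq_exp2l //; case/andP: hj.
have /dvdnP[c ec] : p ^ j %| p ^ k by rewrite dvdn_exp2l //; case/andP: hj.
have c_gt0 : 0 < c.
  by case: c ec => // /eqP; rewrite mul0n expn_eq0; case: (p) p_gt1.
have modE v : 0 < v -> v <= q -> (p ^ k - v) %% p ^ j = p ^ j - v.
  move=> v_gt0 le_vq; rewrite ec -(prednK c_gt0) mulSn addnC -addnBA; last by lia.
  by rewrite modnMDl modn_small //; lia.
rewrite /carry !modE; lia.
Qed.

Let u_gt0 : 0 < u. Proof. exact: leq_trans g_gt0 le_gu. Qed.
Let u'_gt0 : 0 < u'. Proof. exact: leq_trans g_gt0 le_gu'. Qed.
Let le_uq : u <= q. Proof. exact: leq_trans (leq_addr _ _) le_uu'. Qed.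
Let le_u'q : u' <= q. Proof. exact: leq_trans (leq_addl _ _) le_uu'. Qed.
Let q_gt0 : 0 < q. Proof. by rewrite expn_gt0 prime_gt0. Qed.
Let pqE : p ^ k = p * q. Proof. by rewrite -expnS prednK //; lia. Qed.
Let le_q_pq : q <= p ^ k. Proof. by rewrite pqE leq_pmull // prime_gt0. Qed.

Let k1 : k.-1.+1 = k. Proof. by lia. Qed.
Let k2 : k.-2.+1 = k.-1. Proof. by lia. Qed.
Let k3 : 2 + k.-2 = k. Proof. by lia. Qed.

Lemma block_split v : v <= q -> p ^ k - v = (p.-1 * q) + (q - v).
Proof. by move=> le_vq; rewrite pqE -(prednK (prime_gt0 p_pr)) mulSn /=; lia. Qed.

Lemma block_residue v x : 0 < v -> v <= q -> p ^ k %| x + v ->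
  exists2 c, p ^ k %| c & x = c + (p ^ k - v).
Proof.
move=> v_gt0 le_vq /dvdnP[[|c] ec]; first by lia.
by exists (c * p ^ k); [rewrite dvdn_mull | move: ec; rewrite mulSn; lia].
Qed.

Lemma dvd_bin_small_block : p %| 'C((q - u) + (q - u'), q - u).
Proof.
rewrite -[X in X %| _]expn1; apply: (@carries_dvd_bin p _ _ k.-1) => //; first by lia.
move=> i hi; have -> : i = k.-1 by lia.
by rewrite /carry -/q !modn_small; lia.
Qed.

Lemma dvd_bin_large_block : p ^ 2 %| 'C((p ^ k - u) + (p ^ k - u'), p ^ k - u).
Proof.
apply: (@carries_dvd_bin p _ _ k.-1) => //; first by lia.
by move=> i hi; apply: carry_block; lia.
Qed.

(** One factor [p] comes from blocks of length [p ^ k.-1]: the top digit [p.-1]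
    is split off by Vandermonde's identity, and in what remains either the
    coefficient or the block sum is divisible by [p]. *)
Lemma shift_conv_dvd a a' e : p ^ k %| e + g -> q %| a -> q %| a' ->
  p %| shift_conv (p ^ k - u) (p ^ k - u') a a' e.
Proof.
move=> dvd_eg dvda dvda'.
rewrite (block_split le_uq) (block_split le_u'q) shift_convD.
apply: dvdn_sum => b _; apply: dvdn_sum => b' _.
have dvd_pq : p ^ (1 + k.-2) %| p.-1 * q by rewrite dvdn_mull // add1n k2.
have [dvdb|ndb] := boolP (q %| b); last first.
  apply/dvdn_mulr/dvdn_mulr; rewrite -[X in X %| _]expn1.
  by apply: (@prime_power_dvd_bin p 1 k.-2); rewrite // k2.
have [dvdb'|ndb'] := boolP (q %| b'); last first.
  apply/dvdn_mulr/dvdn_mull; rewrite -[X in X %| _]expn1.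
  by apply: (@prime_power_dvd_bin p 1 k.-2); rewrite // k2.
apply: dvdn_mull.
have /dvdnP[c ->] : q %| a + b by rewrite dvdn_add.
have /dvdnP[c' ->] : q %| a' + b' by rewrite dvdn_add.
apply: (@shift_conv_block_dvd _ q u u' g) => //; last exact: dvd_bin_small_block.
- exact/andP.
- exact/andP.
by apply: dvdn_trans dvd_eg; rewrite pqE dvdn_mull.
Qed.

(** Splitting off the multiples of [p ^ k] in [w] and [w'] leaves terms
    with two outer coefficients and one convolution.  An outer index that is
    not divisible by [p ^ k.-1] supplies [p ^ 2] at once; one that is divisible
    by [p ^ k.-1] but not by [p ^ k] supplies one [p], and the convolution a
    second one; if both indices are divisible by [p ^ k], the convolution is
    empty or a complete block, hence divisible by [p ^ 2]. *)
Lemma ball_size_dvd w w' e :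
  p ^ k %| w + u -> p ^ k %| w' + u' -> p ^ k %| e + g -> p ^ 2 %| ball_size w w' e.
Proof.
move=> dvdw dvdw' dvde.
have [W dvdW ->] : exists2 c, p ^ k %| c & w = c + (p ^ k - u).
  exact: block_residue.
have [W' dvdW' ->] : exists2 c, p ^ k %| c & w' = c + (p ^ k - u').
  exact: block_residue.
have -> : ball_size (W + (p ^ k - u)) (W' + (p ^ k - u')) e =
  shift_conv (W + (p ^ k - u)) (W' + (p ^ k - u')) 0 0 e.
  by apply: eq_bigr => i _; rewrite /shift_bin !leq0n !subn0.
rewrite shift_convD; apply: dvdn_sum => b _; apply: dvdn_sum => b' _; rewrite !add0n.
have dvd2 M x : p ^ k %| M -> ~~ (q %| x) -> p ^ 2 %| 'C(M, x).
  by move=> dM nx; apply: (@prime_power_dvd_bin p 2 k.-2); rewrite ?k2 ?k3.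
have dvd1 M x : p ^ k %| M -> ~~ (p ^ k %| x) -> p %| 'C(M, x).
  move=> dM nx; rewrite -[X in X %| _]expn1.
  by apply: (@prime_power_dvd_bin p 1 k.-1); rewrite ?add1n ?k1.
have [dvdb|ndb] := boolP (q %| b); last by rewrite dvdn_mulr // dvdn_mulr // dvd2.
have [dvdb'|ndb'] := boolP (q %| b'); last by rewrite dvdn_mulr // dvdn_mull // dvd2.
have dvdS : p %| shift_conv (p ^ k - u) (p ^ k - u') b b' e by apply: shift_conv_dvd.
have [dvdbk|ndbk] := boolP (p ^ k %| b); last first.
  by rewrite -mulnn dvdn_mul // dvdn_mulr // dvd1.
have [dvdbk'|ndbk'] := boolP (p ^ k %| b'); last first.
  by rewrite -mulnn dvdn_mul // dvdn_mull // dvd1.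
apply: dvdn_mull; case/dvdnP: dvdbk => c ->; case/dvdnP: dvdbk' => c' ->.
apply: (@shift_conv_block_dvd _ (p ^ k) u u' g) => //; last exact: dvd_bin_large_block.
- by rewrite u_gt0 (leq_trans le_uq).
- exact/andP.
exact: leq_trans le_u'q le_q_pq.
Qed.

End BallDivisible.

(** * Parameters of a hypothetical code *)

(** Two codewords are at distance more than [2 * e], which bounds [w] and [n - w];
    if both are equal to [2 * e + 1], then distinct codewords are complementary
    and the code is one of the trivial ones. *)
Lemma nontrivial_params n w e (C : {set {set 'I_n}}) :
  0 < e -> w <= n -> perfect_code w e C -> ~ trivial_code w e C ->
  exists X, [/\ X \in C, 2 * e < w, 2 * e < n - w &
    ~~ ((w == 2 * e + 1) && (n - w == 2 * e + 1))].
Proof.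
move=> e_gt0 le_wn perfC ntriv.
have [X XC] : exists X, X \in C.
  have [Y _ cY] : exists2 Y : {set 'I_n}, Y \subset setT & #|Y| = w.
    by apply: exists_subset; rewrite cardsT card_ord.
  by have [X XC _] := perfect_cover perfC cY; exists X.
have cX := perfect_card perfC XC.
have card_c Y : Y \in C -> #|~: Y| = n - w.
  by move=> YC; rewrite cardsCs setCK card_ord (perfect_card perfC YC).
have [Z ZC neXZ] : exists2 Z, Z \in C & X != Z.
  have [/existsP[Z /andP[ZC neXZ]]|/existsPn h] := boolP [exists Z, (Z \in C) && (X != Z)].
    by exists Z.
  case: ntriv; apply: Or32; apply/eqP/cards1P; exists X; apply/setP=> Z; rewrite inE.
  apply/idP/eqP => [ZC|-> //].
  by have := h Z; rewrite ZC /= negbK => /eqP.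
have dXZ := perfect_dist perfC XC ZC neXZ.
exists X; split => //.
- by rewrite -cX; apply: leq_trans dXZ (subset_leq_card (subsetDl _ _)).
- rewrite -(card_c Z ZC); apply: leq_trans dXZ (subset_leq_card _).
  by rewrite setDE subsetIr.
apply/negP=> /andP[/eqP ew /eqP ew']; apply: ntriv; apply: Or33.
have opp Y : Y \in C -> X != Y -> Y = ~: X.
  move=> YC neXY; have := perfect_dist perfC XC YC neXY => dXY.
  apply/eqP; rewrite eqEcard (card_c X XC) ew' (perfect_card perfC YC) ew leqnn andbT.
  rewrite -disjoints_subset -setI_eq0 -cards_eq0 setIC.
  have := cardsID Y X; rewrite cX; lia.
split; [lia|lia|exists X; first by rewrite inE cX].
apply/setP=> Y; rewrite !inE; apply/idP/orP => [YC|[/eqP -> //|/eqP ->]].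
  by have [->|neXY] := eqVneq X Y; [left | right; apply/eqP/opp].
by rewrite -(opp Z ZC neXZ).
Qed.

(** In the integers put [x = w - e.+1 - A] and [x + y = w' - e.+1 - A], where
    [A = e * e.+2].  The hypothesis is
    [B ^ 2 <= x * (x + y)] with [B = e * e.+1].  The factors cannot both be
    negative, since they are at least [- B] and not both equal to it; so both are positive and
    [B <= x + y].  The rest is the expansion of
    [(B + 4 + x) * (B + 4 + x + 2 * y)]. *)
Lemma design_range_arith e w w' k : 2 * e < w -> w <= w' ->
  ~~ ((w == 2 * e + 1) && (w' == 2 * e + 1)) -> 0 < e ->
  e * e + e * e.+2 * (w + w' - (4 * e + 2)) <= (w - e.+1) * (w' - e.+1) ->
  2 * k + 3 <= w ->
  e <= w - k.+1 /\ k * e ^ 2 < (w - k.+1 - e + 1) * (w' - k.+1 - e + 1).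
Proof.
move=> lt_ew le_ww' ne e_gt0 bound le_kw.
have lt_A : e * e.+2 < w - e.+1.
  rewrite ltnNge; apply/negP => le_A.
  have [x ex] : exists x, w = 2 * e + 1 + x by exists (w - (2 * e + 1)); lia.
  have [y ey] : exists y, w' = 2 * e + 1 + x + y by exists (w' - w); lia.
  subst w w'.
  have e1 : 2 * e + 1 + x - e.+1 = e + x by lia.
  have e2 : 2 * e + 1 + x + y - e.+1 = e + x + y by lia.
  have e3 : 2 * e + 1 + x + (2 * e + 1 + x + y) - (4 * e + 2) = x + x + y by lia.
  rewrite e1 e2 e3 in bound le_A *.
  have xy : 0 < x + y by lia.
  clear -e_gt0 bound le_A xy.
  have [z ez] : exists z, e * e.+2 = e + x + z by exists (e * e.+2 - (e + x)); lia.
  nia.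
have [x ex] : exists x, w = e + 1 + e * e.+2 + x by exists (w - (e + 1 + e * e.+2)); lia.
have [y ey] : exists y, w' = e + 1 + e * e.+2 + x + y by exists (w' - w); lia.
subst w w'.
have h1 : (e * e.+1) * (e * e.+1) <= x * (x + y).
  clear le_kw.
  have e1 : e + 1 + e * e.+2 + x - e.+1 = e * e.+2 + x by lia.
  have e2 : e + 1 + e * e.+2 + x + y - e.+1 = e * e.+2 + x + y by lia.
  have e3 : e + 1 + e * e.+2 + x + (e + 1 + e * e.+2 + x + y) - (4 * e + 2) + 2 * e = 2 * (e * e.+2) + 2 * x + y by nia.
  rewrite e1 e2 in bound.
  move: (_ - (4 * e + 2)) bound e3 => v bound e3.
  clear -bound e3.
  nia.
clear bound lt_A ne le_ww' lt_ew.
have h2 : e * e.+1 <= x + y by clear -h1; nia.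
split; first by clear -le_kw e_gt0; nia.
set B := e * e.+1 in h1 h2.
have lt_k : 4 * k <= 2 * (e * e.+2 + e + x) - 4 by lia.
have le_a : B + 4 + x <= 2 * (e + 1 + e * e.+2 + x - k.+1 - e + 1) by rewrite /B; lia.
have le_b : B + 4 + x + 2 * y <= 2 * (e + 1 + e * e.+2 + x + y - k.+1 - e + 1) by rewrite /B; lia.
set a := (e + 1 + e * e.+2 + x - k.+1 - e + 1) in le_a *.
set b := (e + 1 + e * e.+2 + x + y - k.+1 - e + 1) in le_b *.
move: a b le_a le_b => a b le_a le_b.
rewrite -(ltn_pmul2l (isT : 0 < 4)).
apply: (@leq_trans ((B + 4 + x) * (B + 4 + x + 2 * y))).
  have h3 : B * B <= x * x + x * y + x * y by lia.
  have h4 : e.+1 * B <= e.+1 * (x + y) by rewrite leq_mul2l h2 orbT.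
  have h5 : 4 * k * (e * e) <= (2 * (e * e.+2 + e + x) - 4) * (e * e) by rewrite leq_mul2r lt_k orbT.
  have h6 : 0 <= e * e * y by [].
  rewrite mulnA -mulnn; apply: leq_ltn_trans h5 _.
  rewrite mulnBl; clear lt_k le_a le_b; rewrite /B in h2 h3 h4 *; lia.
have -> : 4 * (a * b) = (2 * a) * (2 * b) by lia.
exact: leq_mul.
Qed.

(** The number [m] is the leading base-[p] digit [d] of [w] followed by zeros.
    From [w < (d + 1) * p ^ s] and [d < p] one gets
    [3 * (m + w') < (7 * d + 4) * p ^ s <= 3 * p ^ s.+2], so only one carry can
    occur. *)
Lemma top_digit p w w' : prime p -> 0 < w -> w <= w' -> 3 * w' <= 4 * w ->
  exists m, [/\ m <= w, 2 * (w - m) < w & logn p 'C(m + w', m) <= 1].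
Proof.
move=> p_pr w_gt0 le_ww' le_w'; have p_gt1 := prime_gt1 p_pr.
have pow_gt0 i : 0 < p ^ i by rewrite expn_gt0 prime_gt0.
have /andP[le_w lt_w] := trunc_log_bounds p_gt1 w_gt0.
set s := trunc_log p w in le_w lt_w.
have ew := divn_eq w (p ^ s); have lt_r := ltn_pmod w (pow_gt0 s).
have d_gt0 : 0 < w %/ p ^ s by rewrite divn_gt0.
have lt_dp : w %/ p ^ s < p by rewrite ltn_divLR // -expnS.
move: (_ %/ _) (_ %% _) ew lt_r d_gt0 lt_dp => d r ew lt_r d_gt0 lt_dp.
have le_P : p ^ s <= d * p ^ s by rewrite leq_pmull.
have lt_m : d * p ^ s < p ^ s.+1 by rewrite expnS ltn_mul2r pow_gt0.
exists (d * p ^ s); split; [lia|lia|].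
apply: (@logn_bin_le1 p _ _ s) => //; first exact: dvdn_mull.
rewrite -(ltn_pmul2l (isT : 0 < 3)).
apply: (@leq_trans ((7 * d + 4) * p ^ s)); first by rewrite mulnDl; lia.
rewrite !expnS mulnA mulnA leq_mul2r; apply/orP; right.
nia.
Qed.

Section NonExistence.
Variables (p k g e : nat).
Hypotheses (p_pr : prime p) (k_ge2 : 2 <= k) (g_gt0 : 0 < g) (le_g : 4 * g <= p ^ k.-1 + 2).
Hypotheses (e_gt0 : 0 < e) (dvd_eg : p ^ k %| e + g).
Let p_gt1 : 1 < p. Proof. exact: prime_gt1. Qed.
Let pow_gt0 i : 0 < p ^ i. Proof. by rewrite expn_gt0 prime_gt0. Qed.
Let pkE : p ^ k = p * p ^ k.-1. Proof. by rewrite -expnS prednK //; lia. Qed.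
Let pow_ge2 : 2 <= p ^ k.-1.
Proof. by rewrite -[2]expn1 (leq_trans (_ : _ <= p ^ 1)) ?leq_exp2l ?leq_exp2r //; lia. Qed.
Let le_2q : 2 * p ^ k.-1 <= p ^ k. Proof. by rewrite pkE leq_mul2r p_gt1 orbT. Qed.
Let lt_g : g < p ^ k. Proof. by lia. Qed.
Let le_pk : p ^ k <= e + g. Proof. by apply: dvdn_leq dvd_eg; lia. Qed.
Let e_ge3 : 3 <= e. Proof. by lia. Qed.

(** The carry out of the [k] lowest digits in the addition of [g] and
    [w - e.+1] says that [w - e.+1] is within [g] of a multiple of [p ^ k]
    from below. *)
Lemma residue_of_code n w (C : {set {set 'I_n}}) X : perfect_code w e C -> X \in C ->
  2 * e < w -> 2 * e < n - w -> exists u, [/\ g <= u, u < 2 * g & p ^ k %| w + u].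
Proof.
move=> perfC XC lt_ew lt_ew'.
have dvdC : 'C(e + g, g) %| 'C(w - e.+1 + g, g).
  by apply: (steiner_dvd perfC XC); lia.
have hk : 0 < k by lia.
have hg : 0 < g < p ^ k by rewrite g_gt0.
have := carry_bin_dvd p_pr hk hg dvd_eg dvdC.
rewrite /carry modn_small //.
have lt_r := ltn_pmod (w - e.+1) (pow_gt0 k).
have ew := divn_eq (w - e.+1) (p ^ k).
move: (_ %/ _) (_ %% _) lt_r ew => c r lt_r ew le_r.
exists (p ^ k + g - 1 - r); split; [lia|lia|].
have -> : w + (p ^ k + g - 1 - r) = c * p ^ k + (e + g + p ^ k) by clear dvdC; lia.
by rewrite dvdn_add ?dvdn_mull // dvdn_add.
Qed.

Lemma no_code_half n w (C : {set {set 'I_n}}) :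
  w <= n -> w <= n - w -> perfect_code w e C -> ~ trivial_code w e C -> False.
Proof.
move=> le_wn le_ww' perfC ntriv.
have [X [XC lt_ew lt_ew' ne]] := nontrivial_params e_gt0 le_wn perfC ntriv.
have [u [le_gu lt_u dvdu]] := residue_of_code perfC XC lt_ew lt_ew'.
have [u' [le_gu' lt_u' dvdu']] : exists u, [/\ g <= u, u < 2 * g & p ^ k %| (n - w) + u].
  have XC' : ~: X \in [set ~: Z | Z in C] by apply: imset_f.
  by apply: (residue_of_code (perfect_codeC le_wn perfC) XC'); rewrite ?subKn.
have dvdPhi : p ^ 2 %| ball_size w (n - w) e.
  have le_uu' : u + u' <= p ^ k.-1 by clear dvdu dvdu'; lia.
  exact: (ball_size_dvd p_pr k_ge2 g_gt0 le_gu le_gu' le_uu').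
clear dvdu dvdu'.
have e1w : e.+2 <= w by lia.
have e1w' : e.+2 <= n - w by lia.
have layer2 := second_layer perfC XC e1w e1w' lt_ew lt_ew'.
have roos : e * (n - w - e) <= e.+1 * (w - e.+1) by apply: (roos_packing perfC XC); lia.
have le_w' : 3 * (n - w) <= 4 * w.
  rewrite -(leq_pmul2l e_gt0).
  have : 3 * (e * (n - w - e)) <= 3 * (e.+1 * (w - e.+1)) by rewrite leq_mul2l roos orbT.
  have : 3 * w <= e * w by rewrite leq_mul2r e_ge3 orbT.
  have -> : n - w = (n - w - e) + e by lia.
  have -> : w = (w - e.+1) + e.+1 by lia.
  move: (n - w - e) (w - e.+1) => x y; clear; nia.
have w_gt0 : 0 < w by lia.
have [m [le_mw lt_m log_le1]] := top_digit p_pr w_gt0 le_ww' le_w'.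
have dvdN : ball_size w (n - w) e %| 'C(n - (w - m), w - (w - m)).
  apply: (perfect_design_dvd perfC) => //; try lia.
  move=> j lt_j.
  have := @design_range_arith e w (n - w) j lt_ew le_ww' ne e_gt0.
  rewrite subnKC // => /(_ layer2) [|le_e lt_R]; first by lia.
  suff : (0 < layer_value (w - j.+1) (n - w - j.+1) j e)%R by apply: contraTneq => ->.
  by apply: layer_value_gt0; rewrite ?e_gt0 //; lia.
have := dvdn_trans dvdPhi dvdN.
have -> : w - (w - m) = m by rewrite subKn.
have -> : n - (w - m) = m + (n - w) by clear dvdPhi dvdN; lia.
rewrite pfactor_dvdn ?bin_gt0 ?leq_addr //.
by rewrite leqNgt ltnS log_le1.
Qed.

End NonExistence.

Theorem theorem4p1 (p r e : nat) (hp : prime p) (hr : 0 < r) (he : 0 < e)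
    (hpe : p ^ (r - 1) <= e < p ^ r)
    (hgamma : exists k : nat, 2 <= k <= r /\
       1 <= (p ^ r - e) %% p ^ k <= (p ^ (k - 1) + 2) %/ 4) :
  forall n w : nat, 1 <= w <= n - 1 ->
  ~ (exists C : {set {set 'I_n}}, perfect_code w e C /\ ~ trivial_code w e C).
Proof.
move=> n w /andP[w_gt0 lt_wn] [C [perfC ntriv]].
case: hgamma => k [/andP[k_ge2 le_kr] /andP[g_gt0]].
rewrite leq_divRL // subn1 mulnC => le_g.
have le_wn : w <= n by lia.
have dvd_eg : p ^ k %| e + (p ^ r - e) %% p ^ k.
  have /andP[_ lt_e] := hpe.
  rewrite -(dvdn_addr _ (dvdn_mull ((p ^ r - e) %/ p ^ k) (dvdnn _))).
  by rewrite addnCA -divn_eq subnKC ?dvdn_exp2l // ltnW.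
have [le_ww'|/ltnW lt_w'w] := leqP w (n - w).
  exact: (no_code_half hp k_ge2 g_gt0 le_g he dvd_eg le_wn le_ww' perfC ntriv).
apply: (@no_code_half p k _ e hp k_ge2 g_gt0 le_g he dvd_eg n (n - w) [set ~: X | X in C]).
- exact: leq_subr.
- by rewrite subKn.
- exact: perfect_codeC.
case=> [e0|c1|[en ew [Y Yw eC]]].
- by rewrite e0 in he.
- by apply: ntriv; apply: Or32; rewrite -c1 card_imset //; apply: setC_inj.
apply: ntriv; apply: Or33; split; [lia | lia | exists (~: Y)].
  by move: Yw; rewrite !inE => /eqP cY; rewrite cardsCs setCK card_ord cY subKn.
rewrite setCK; apply: (imset_inj (@setC_inj _)).
by rewrite eC imsetU1 imset_set1 setCK.
Qed.
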